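(* For a nonzero integer $n$, let $q(n)$ be the number of integer quadratic polynomials $f(x)=ax^2+bx+c$ ($a,b,c\in\mathbb{Z}$) with $a(b^2-4ac)=n$, counted up to the transformations $x\mapsto x+t$ ($t\in\mathbb{Z}$). Let $q_2(n)$, $q^+(n)$, $q_2^+(n)$ be the number of such classes with $2\mid b$, with real roots (i.e. $b^2-4ac>0$), and with both conditions, respectively. Then for every nonzero integer $n$, \[q_2^+(4n)=q(n),\qquad q_2(4n)=2q^+(n).\] *)

(* Defs.v *)
From HB Require Import structures.
From mathcomp Require Import all_boot all_order all_algebra.
From mathcomp Require Import finmap.
From mathcomp Require Import all_classical.
From mathcomp Require Import zify ring lra.

Set Implicit Arguments.
Unset Strict Implicit.
Unset Printing Implicit Defensive.

Import Order.TTheory GRing.Theory Num.Theory.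
Local Open Scope classical_set_scope.
Local Open Scope ring_scope.

Definition disc (f : {poly int}) : int := f`_1 ^+ 2 - 4 * f`_2 * f`_0.

Definition translate (t : int) (f : {poly int}) : {poly int} :=
  f \Po ('X + t%:P).

Definition tclass (f : {poly int}) : set {poly int} :=
  [set translate t f | t in [set: int]].

Definition quads (n : int) : set {poly int} :=
  [set f : {poly int} | size f = 3%N /\ f`_2 * disc f = n].

Definition even_mid : set {poly int} := [set f : {poly int} | (2 %| f`_1)%Z].

Definition real_roots : set {poly int} := [set f : {poly int} | 0 < disc f].

(* [fset_set] is the empty set on infinite sets; see [finite_tclasses] below.
   On quadratic polynomials [even_mid] and [real_roots] are invariant under
   translation: [even_mid_translate] and [disc_translate]. *)
Definition num_classes (A : set {poly int}) : nat :=
  #|` fset_set (tclass @` A)|%fset.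

Definition q (n : int) : nat := num_classes (quads n).
Definition q2 (n : int) : nat := num_classes (quads n `&` even_mid).
Definition qp (n : int) : nat := num_classes (quads n `&` real_roots).
Definition q2p (n : int) : nat :=
  num_classes (quads n `&` (even_mid `&` real_roots)).

Definition mkquad (a b c : int) : {poly int} :=
  a *: 'X^2 + b *: 'X + c%:P.

Lemma mkquadE (f : {poly int}) :
  (size f <= 3)%N -> f = mkquad f`_2 f`_1 f`_0.
Proof.
move=> sf; apply/polyP => i; rewrite !(coefD, coefZ, coefXn, coefX, coefC).
case: i => [|[|[|i]]] /=; rewrite ?mulr0 ?mulr1 ?addr0 ?add0r //.
by rewrite nth_default // (leq_trans sf).
Qed.

Lemma mkquad_coef a b c :
  (((mkquad a b c)`_2 = a) * ((mkquad a b c)`_1 = b)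
    * ((mkquad a b c)`_0 = c))%type.
Proof.
by do !split; rewrite !(coefD, coefZ, coefXn, coefX, coefC) /=
   ?mulr0 ?mulr1 ?addr0 ?add0r.
Qed.

Lemma translate_mkquad t a b c : translate t (mkquad a b c) =
  mkquad a (b + 2 * a * t) (a * t ^+ 2 + b * t + c).
Proof.
rewrite /translate /mkquad !comp_polyD !comp_polyZ comp_Xn_poly comp_polyX.
rewrite comp_polyC -!mul_polyC !(polyCD, polyCM) /=.
by ring.
Qed.

Lemma translateD s t f : translate s (translate t f) = translate (s + t) f.
Proof.
rewrite /translate -comp_polyA comp_polyD comp_polyX comp_polyC.
by rewrite polyCD addrA.
Qed.

Lemma tclass_translate t f : tclass (translate t f) = tclass f.
Proof.
apply/seteqP; split=> g [s _ <-] /=.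
  by exists (s + t) => //; rewrite translateD.
by exists (s - t) => //; rewrite translateD subrK.
Qed.

Lemma disc_translate t (f : {poly int}) : (size f <= 3)%N -> disc (translate t f) = disc f.
Proof.
move=> /mkquadE ->; rewrite translate_mkquad /disc.
by rewrite !mkquad_coef; ring.
Qed.

Lemma even_mid_translate t (f : {poly int}) : (size f <= 3)%N ->
  even_mid (translate t f) = even_mid f.
Proof.
move=> /mkquadE ->; rewrite translate_mkquad /even_mid /=.
by rewrite !mkquad_coef rpredDr // -mulrA dvdz_mulr.
Qed.

Lemma finite_tclasses (n : int) (A : set {poly int}) :
  n != 0 -> A `<=` quads n -> finite_set (tclass @` A).
Proof.
move=> n0 An.
pose N := `|n|%N; pose M := (4 * N * N + N)%N.
pose h (u : 'I_(2 * M).+1) : int := (u : nat)%:Z - M%:Z.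
pose F (x : 'I_(2 * M).+1 * 'I_(2 * M).+1 * 'I_(2 * M).+1) : set {poly int} :=
  tclass (mkquad (h x.1.1) (h x.1.2) (h x.2)).
have hP (z : int) : (`|z| <= M)%N -> exists u, h u = z.
  move=> zM; have lt : (absz (z + M%:Z)%R < (2 * M).+1)%N by lia.
  by exists (Ordinal lt); rewrite /h /=; lia.
apply: (@sub_finite_set _ _ (range F)); last first.
  exact: finite_image (@finite_finset _ _).
move=> _ [f /An [sf fn] <-].
move: fn; rewrite (@mkquadE f) ?sf //.
move: (f`_2) (f`_1) (f`_0) => a b c {sf}.
rewrite /disc !mkquad_coef => fn.
have a0 : a != 0 by apply: contra_neq n0 => a0; rewrite -fn a0 mul0r.
have a20 : 2 * a != 0 by rewrite mulf_neq0.
pose t := - (b %/ (2 * a))%Z.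
rewrite -(tclass_translate t) translate_mkquad.
set b' := b + _; set c' := _ + c.
have b'E : b' = (b %% (2 * a))%Z.
  by rewrite /b' /t {1}(divz_eq b (2 * a)); ring.
have b'0 : 0 <= b' by rewrite b'E modz_ge0.
have b'lt : b' < `|2 * a| by rewrite b'E ltz_mod.
have fn' : a * (b' ^+ 2 - 4 * a * c') = n by rewrite -fn /b' /c'; ring.
clearbody b' c' t.
have Na : (`|a| <= N)%N.
  by apply: dvdn_leq; [rewrite absz_gt0|rewrite /N -fn' abszM dvdn_mulr].
have ND : (`|(b' ^+ 2 - 4 * a * c')%R| <= N)%N.
  by apply: dvdn_leq; [rewrite absz_gt0|rewrite /N -fn' abszM dvdn_mull].
have N1 : (0 < N)%N by rewrite absz_gt0.
have NN : (N <= N * N)%N by rewrite -{1}(muln1 N) leq_mul2l N1 orbT.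
have NM : (2 * N <= M)%N by rewrite /M -mulnA; move: (N * N)%N NN => K; lia.
have aM : (`|a| <= M)%N by apply: leq_trans NM; lia.
have bN : (`|b'| <= 2 * N)%N by clear -b'0 b'lt Na; lia.
have bM : (`|b'| <= M)%N by apply: leq_trans NM.
have cM : (`|c'| <= M)%N.
  have b2 : (`|(b' ^+ 2)%R| <= 4 * N * N)%N.
    rewrite abszX (_ : 4 * N * N = (2 * N) ^ 2)%N ?leq_sqr //.
    by rewrite expnMn -mulnA mulnn.
  have c4 : (`|(4 * a * c')%R| <= M)%N.
    rewrite /M; move: (4 * N * N)%N b2 ND => K.
    by move: (b' ^+ 2) (4 * a * c') => x y; clear; lia.
  apply: leq_trans c4; rewrite !abszM leq_pmull // muln_gt0 /=.
  by rewrite absz_gt0.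
have [u ua] := hP _ aM; have [v vb] := hP _ bM; have [w wc] := hP _ cM.
by exists (u, v, w) => //; rewrite /F /= ua vb wc.
Qed.

(* Main.v *)
(* The leading coefficient [a] and [b] modulo [2a] determine a class with given
   [n], so with [nsqrt d a] the number of square roots of [d] modulo [a] the four
   counts become sums of [nsqrt (+-d) a] and [nsqrt (+-d) (4a)] over the
   factorisations [|n| = a d].  At an odd prime the local factor of such a sum is
   [A + B (u/p)] for the even powers of [p] in [d] and [B] for the odd ones, where
   [u] is the unit part of [d].  Expanding the product over the odd primes
   therefore gives a sum, over ordered pairs of disjoint sets of primes with
   products [E] and [M], of Jacobi symbols [(M/E)] with weights symmetric in the
   pair, times a 2-adic factor depending on [E] and [M] modulo 8.  Exchanging the
   two sets and applying quadratic reciprocity reduces both identities to a finite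
   check of the 2-adic factors, uniform in the power of 2 dividing [n]. *)
Require Import Defs.
From mathcomp Require Import all_boot all_order all_algebra.
From mathcomp Require Import finfield.
From mathcomp Require Import finmap all_classical.
From mathcomp Require Import zify ring.

Set Implicit Arguments.
Unset Strict Implicit.
Unset Printing Implicit Defensive.
Import Order.TTheory GRing.Theory Num.Theory.
Local Open Scope ring_scope.

(** * Square roots modulo an integer *)

Definition nsqrt (d : int) (a : nat) : int :=
  \sum_(0 <= x < a) ((a%:Z %| x%:Z ^+ 2 - d)%Z)%:R.

Lemma sum_blocks (G : nat -> int) (m n : nat) :
  \sum_(0 <= x < m * n) G x = \sum_(0 <= y < n) \sum_(0 <= t < m) G (y + t * n)%N.
Proof.
rewrite exchange_big /=; elim: m => [|m IHm]; first by rewrite !big_geq.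
rewrite big_nat_recr //= -IHm mulSn addnC (big_cat_nat (n := (m * n)%N)) ?leq_addr //=.
congr (_ + _); rewrite -{1}[(m * n)%N]add0n big_addn addKn.
by apply: eq_bigr => i _.
Qed.

Lemma sum_periodic (G : nat -> int) (m n : nat) :
  (forall x, G (x + n)%N = G x) ->
  \sum_(0 <= x < m * n) G x = \sum_(0 <= x < n) G x *+ m.
Proof.
move=> Gn; rewrite sum_blocks; apply: eq_bigr => y _.
rewrite (eq_bigr (fun=> G y)) ?sumr_const_nat ?subn0 // => t _.
elim: t => [|t IHt]; first by rewrite addn0.
by rewrite mulSn addnCA addnC Gn.
Qed.

Lemma sum_multiples (G : nat -> int) (p b : nat) : (0 < p)%N ->
  (forall x, ~~ (p %| x)%N -> G x = 0) ->
  \sum_(0 <= x < p * b) G x = \sum_(0 <= y < b) G (p * y)%N.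
Proof.
move=> p0 Gp; rewrite mulnC sum_blocks big_ltn //.
rewrite [X in _ + X = _](_ : _ = 0); first rewrite addr0.
  by apply: eq_bigr => y _; rewrite mulnC add0n.
rewrite big_nat; apply: big1 => y /andP [y1 yp]; apply: big1 => t _; apply: Gp.
by rewrite dvdn_addl ?dvdn_mull //; apply/negP => /dvdn_leq; lia.
Qed.

Lemma dvdz_congr (a : nat) (x y : int) (k : int) :
  x - y = a%:Z * k -> (a%:Z %| x)%Z = (a%:Z %| y)%Z.
Proof.
by move=> xy; rewrite -(subrK y x) xy rpredDl ?dvdz_mulr.
Qed.

Lemma nsqrt_congr (d d' : int) (a : nat) (k : int) :
  d - d' = a%:Z * k -> nsqrt d a = nsqrt d' a.
Proof.
move=> dd; apply: eq_bigr => x _; congr (_%:R); congr nat_of_bool.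
by apply: (@dvdz_congr _ _ _ (- k)); rewrite mulrN -dd; ring.
Qed.

Lemma nsqrt1 d : nsqrt d 1 = 1.
Proof. by rewrite /nsqrt big_nat1 dvd1z. Qed.

(** Chinese remainder theorem: reduction modulo [a] and [b] is a bijection on residues that respects
    the root condition. *)
Lemma nsqrtM (d : int) (a b : nat) : (0 < a)%N -> (0 < b)%N -> coprime a b ->
  nsqrt d (a * b) = nsqrt d a * nsqrt d b.
Proof.
case: a b => [|a] [|b] // _ _ cab.
rewrite /nsqrt !big_mkord.
rewrite big_distrlr /= pair_big /=.
pose f (x : 'I_(a.+1 * b.+1)) : 'I_a.+1 * 'I_b.+1 := (inord (x %% a.+1), inord (x %% b.+1)).
have f_inj : injective f.
  move=> x y [] /(congr1 val) /= + /(congr1 val) /=.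
  rewrite !inordK ?ltn_pmod // => xa xb; apply: val_inj => /=.
  rewrite -(modn_small (ltn_ord x)) -(modn_small (ltn_ord y)).
  by apply/eqP; rewrite chinese_remainder // xa xb !eqxx.
have f_bij : bijective f.
  by apply: inj_card_bij f_inj _; rewrite card_prod !card_ord.
rewrite (reindex f) /=; last exact: onW_bij.
apply: eq_bigr => x _.
rewrite !inordK ?ltn_pmod // -natrM mulnb; congr ((nat_of_bool _)%:R).
have red (c : nat) : (c.+1%:Z %| (x %% c.+1)%N%:Z ^+ 2 - d)%Z = (c.+1%:Z %| x%:Z ^+ 2 - d)%Z.
  symmetry; apply: (@dvdz_congr _ _ _ ((x %/ c.+1)%N%:Z *
    ((x %/ c.+1)%N%:Z * c.+1%:Z + 2 * (x %% c.+1)%N%:Z))).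
  rewrite {1}(divn_eq x c.+1) PoszD PoszM; ring.
by rewrite !red PoszM Gauss_dvdz // /coprimez.
Qed.

(** Every root is a multiple [p * y], and [y], running modulo [p * a], only has to satisfy a
    condition of period [a]; hence the factor [p]. *)
Lemma nsqrt_sq_scale (p a : nat) (d : int) : prime p ->
  nsqrt (p%:Z ^+ 2 * d) (p ^ 2 * a) = p%:Z * nsqrt d a.
Proof.
move=> pp; have p0 := prime_gt0 pp; rewrite /nsqrt -mulnn -mulnA sum_multiples //; last first.
  move=> x px; case: dvdzP => // -[k xk]; case/negP: px.
  have : (p %| x ^ 2)%N.
    suff : (p%:Z %| (x ^ 2)%N%:Z)%Z by [].
    apply/dvdzP; exists (p%:Z * d + k * p%:Z * a%:Z); rewrite -mulnn PoszM -expr2.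
    move: xk; rewrite !PoszM => /(canRL (subrK _)) ->; ring.
  by rewrite Euclid_dvdX // => /andP [].
rewrite (@sum_periodic _ p a).
  rewrite mulr_sumr; apply: eq_bigr => y _; rewrite -[_ *+ p]mulr_natl natz.
  congr (_ * (nat_of_bool _)%:R).
  rewrite mulnA !PoszM (_ : _ - _ = p%:Z * p%:Z * (y%:Z ^+ 2 - d)); last by ring.
  by rewrite dvdz_mul2l // mulf_neq0 //; case: p p0 {pp}.
move=> y; congr ((nat_of_bool _)%:R).
apply: (@dvdz_congr _ _ _ (2 * y%:Z + a%:Z)); rewrite !PoszM !PoszD; ring.
Qed.

Lemma sum_indicator (a t : nat) (P : nat -> bool) : (t < a)%N ->
  (forall x, (x < a)%N -> P x = (x == t)) ->
  \sum_(0 <= x < a) (P x)%:R = 1 :> int.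
Proof.
move=> ta Pt; rewrite big_mkord (bigD1 (Ordinal ta)) //= Pt // eqxx.
rewrite big1 ?addr0 // => i it; rewrite Pt //.
by move: it; rewrite -val_eqE /= => /negbTE ->.
Qed.

Lemma dvdz_lt_eq (p x t : nat) : (x < p)%N -> (t < p)%N ->
  (p%:Z %| x%:Z - t%:Z)%Z = (x == t).
Proof.
move=> xp tp; apply/idP/eqP => [|->]; last by rewrite subrr dvdz0.
rewrite /dvdz => /dvdn_leq; lia.
Qed.

Lemma sum_linear (p : nat) (w z : int) : (0 < p)%N -> coprimez z p ->
  \sum_(0 <= t < p) ((p%:Z %| w + z * t%:Z)%Z)%:R = 1 :> int.
Proof.
move=> p0 czp; have [u [v uv]] := Bezoutz z p.
move: czp => /eqP czp; rewrite czp in uv.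
have pn0 : p%:Z != 0 by case: p p0 {uv czp}.
(* The Bezout coefficient [u] inverts [z] modulo [p], so the only solution is [- (w * u)] reduced
   modulo [p]. *)
pose t0 := absz ((- (w * u)) %% p)%Z.
have t0E : t0%:Z = ((- (w * u)) %% p)%Z by rewrite gez0_abs // modz_ge0.
have t0p : (t0 < p)%N by rewrite -ltz_nat t0E ltz_pmod.
apply: (sum_indicator t0p) => x xp; rewrite -(dvdz_lt_eq xp t0p) t0E.
set k := ((- (w * u)) %/ p)%Z.
have dk : ((- (w * u)) %% p)%Z = - (w * u) - k * p by rewrite /k {2}(divz_eq (- (w * u)) p); ring.
rewrite dk; apply/idP/idP => /dvdzP [m mE]; apply/dvdzP.
  exists (u * m + x%:Z * v + k).
  by rewrite !mulrDl -[u * m * _]mulrA -mE -[x%:Z in LHS]mulr1 -uv; ring.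
exists (w * v + z * m - z * k).
rewrite -[w in LHS]mulr1 -[in LHS]uv.
by rewrite !mulrDl -[z * m * _]mulrA -mE; ring.
Qed.

(** Above a root [y] modulo [p ^ k.+1] the candidates are [y + t * p ^ k.+1], and the condition on
    [t] is linear modulo [p] with slope [2 * y], a unit. Above a non-root there is no root. *)
Lemma nsqrt_hensel (p k : nat) (u : int) : prime p -> odd p -> ~~ (p%:Z %| u)%Z ->
  nsqrt u (p ^ k.+2) = nsqrt u (p ^ k.+1).
Proof.
move=> pp po pu; have p0 := prime_gt0 pp.
rewrite /nsqrt expnS sum_blocks; apply: eq_bigr => y _.
set q := (p ^ k.+1)%N; have q0 : q%:Z != 0 by rewrite -lt0n expn_gt0 p0.
have qE (t : nat) : (y + t * q)%N%:Z ^+ 2 - u =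
    (y%:Z ^+ 2 - u) + q%:Z * (2 * y%:Z * t%:Z + t%:Z ^+ 2 * q%:Z).
  by rewrite PoszD PoszM; ring.
have [/dvdzP [w wE]|qn] := boolP (q%:Z %| y%:Z ^+ 2 - u)%Z.
  rewrite -[RHS]/(1 : int) -[RHS](@sum_linear p w (2 * y%:Z)) //; last first.
    rewrite coprimezE abszM !absz_nat coprime_sym prime_coprime // Euclid_dvdM // negb_or.
    apply/andP; split.
      by apply/negP => /dvdn_leq; move: (prime_gt1 pp) po; clear; lia.
    apply: contra pu => py.
    have /dvdnP [m mE] := py.
    apply/dvdzP; exists (m%:Z ^+ 2 * p%:Z - w * (p ^ k)%N%:Z).
    have -> : u = y%:Z ^+ 2 - w * q%:Z by rewrite -wE; ring.
    rewrite /q expnS mE !PoszM; ring.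
  apply: eq_bigr => t _; congr ((nat_of_bool _)%:R).
  rewrite qE wE (_ : _ + _ = (w + 2 * y%:Z * t%:Z + t%:Z ^+ 2 * q%:Z) * q%:Z); last by ring.
  rewrite PoszM dvdz_mul2r // rpredDr // dvdz_mull //.
  by rewrite /q expnS PoszM dvdz_mulr.
apply: big1 => t _; case: (boolP (_ %| _)%Z) => // /dvdzP [m mE]; case/negP: qn.
apply/dvdzP; exists (m * p%:Z - (2 * y%:Z * t%:Z + t%:Z ^+ 2 * q%:Z)).
by move: mE; rewrite qE PoszM => /(canRL (addrK _)) ->; ring.
Qed.

(* For odd [y], exactly one of [y] and [y + 2^(k+2)] lifts a root modulo [2^(k+3)]
   to a root modulo [2^(k+4)]. *)
Lemma nsqrt_hensel2 (k : nat) (u : int) : ~~ (2 %| u)%Z ->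
  nsqrt u (2 ^ k.+4) = nsqrt u (2 ^ k.+3).
Proof.
move=> u2; set q := (2 ^ k.+1)%N.
have e3 : (2 ^ k.+3 = 4 * q)%N by rewrite 2!expnS mulnA.
have e4 : (2 ^ k.+4 = 2 * (4 * q))%N by rewrite expnS e3.
(* Squares have period half the modulus here, so both sums fold in two; it remains to compare the
   pair [y], [y + 2 * q] with [y]. *)
rewrite {1}/nsqrt e4 sum_periodic; last first.
  move=> x; congr ((nat_of_bool _)%:R).
  by apply: (@dvdz_congr _ _ _ (x%:Z + 2 * q%:Z)); rewrite !(PoszM, PoszD); ring.
rewrite /nsqrt e3 [index_iota 0 (4 * q)](_ : _ = index_iota 0 (2 * (2 * q))); last by rewrite mulnA.
rewrite [RHS](@sum_periodic _ 2 (2 * q)); last first.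
  move=> x; congr ((nat_of_bool _)%:R).
  by apply: (@dvdz_congr _ _ _ (x%:Z + q%:Z)); rewrite !(PoszM, PoszD); ring.
rewrite !sumrMnl sum_blocks; congr (_ *+ _); apply: eq_bigr => y _.
rewrite big_nat_recl // big_nat1 mul0n addn0 mul1n -natrD; congr (_%:R).
set Q := (2 * q)%N%:Z.
have QE : ((2 * (4 * q))%N%:Z = 2 * (2 * Q)) by rewrite /Q !PoszM; ring.
have Q2 : ((4 * q)%N%:Z = 2 * Q) by rewrite /Q !PoszM; ring.
have Q0 : 2 * Q != 0.
  by rewrite /Q mulf_neq0 // -lt0n muln_gt0 expn_gt0.
have yE : (y + 2 * q)%N%:Z ^+ 2 - u = (y%:Z ^+ 2 - u) + 2 * Q * (y%:Z + q%:Z).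
  by rewrite PoszD -/Q /Q PoszM; ring.
rewrite QE Q2 yE; have [/dvdzP [w wE]|qn] := boolP (2 * Q %| _)%Z; last first.
  have n1 z : ~~ (2 * (2 * Q) %| (y%:Z ^+ 2 - u) + 2 * Q * z)%Z.
    apply: contra qn => /dvdzP [m mE]; apply/dvdzP; exists (2 * m - z).
    by move: mE => /(canRL (addrK _)) ->; ring.
  by have := n1 0; rewrite mulr0 addr0 => /negbTE ->; rewrite (negbTE (n1 _)).
rewrite wE [2 * Q * (_ + _)]mulrC -mulrDl !dvdz_mul2r //.
have qo : (2 %| q%:Z)%Z by rewrite /q expnS PoszM dvdz_mulr.
have yo : ~~ (2 %| y%:Z)%Z.
  apply: contra u2 => /dvdzP [m mE]; apply/dvdzP; exists (2 * m ^+ 2 - w * Q).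
  have -> : u = y%:Z ^+ 2 - w * (2 * Q) by rewrite -wE; ring.
  by rewrite mE; ring.
by move: qo yo; clear; lia.
Qed.

(** Lifting brings the modulus down to 8, where evaluation shows that 1 is the only odd square, with
    the four odd residues as roots. *)
Lemma nsqrt_pow2 (k : nat) (u : int) : ~~ (2 %| u)%Z ->
  nsqrt u (2 ^ k.+3) = if (u %% 8)%Z == 1 then 4 else 0.
Proof.
move=> u2; elim: k => [|k <-]; last exact: nsqrt_hensel2.
have um : u - (u %% 8)%Z = (2 ^ 3)%N%:Z * (u %/ 8)%Z.
  by rewrite {1}(divz_eq u 8); ring.
rewrite (nsqrt_congr um).
have : [\/ (u %% 8)%Z = 1, (u %% 8)%Z = 3, (u %% 8)%Z = 5 | (u %% 8)%Z = 7].
  have [e|[e|[e|e]]] : (u %% 8)%Z = 1 \/ (u %% 8)%Z = 3 \/ (u %% 8)%Z = 5 \/ (u %% 8)%Z = 7 by lia.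
  - by constructor 1. - by constructor 2. - by constructor 3. - by constructor 4.
by case=> ->; rewrite /nsqrt unlock.
Qed.

Lemma nsqrt_dvd (p : nat) (d : int) : prime p -> (p%:Z %| d)%Z -> nsqrt d p = 1.
Proof.
move=> pp /dvdzP [k dk]; have p0 := prime_gt0 pp.
rewrite (@nsqrt_congr _ 0 _ k); last by rewrite dk subr0 mulrC.
apply: (sum_indicator p0) => x xp; rewrite subr0 dvdzE abszX !absz_nat Euclid_dvdX // andbT.
by rewrite -(dvdz_lt_eq xp p0) subr0.
Qed.

Lemma nsqrt_ramified (p k : nat) (u : int) : prime p -> ~~ (p%:Z %| u)%Z ->
  nsqrt (p%:Z * u) (p ^ k.+2) = 0.
Proof.
move=> pp pu; have p0 := prime_gt0 pp; apply: big1 => x _; case: (boolP (_ %| _)%Z) => // /dvdzP [m mE].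
case/negP: pu.
have /dvdnP [y yE] : (p %| x)%N.
  have : (p%:Z %| x%:Z ^+ 2)%Z.
    apply/dvdzP; exists (m * (p ^ k.+1)%N%:Z + u).
    by rewrite mulrDl -mulrA -PoszM -expnSr -mE; ring.
  by rewrite dvdzE abszX Euclid_dvdX // => /andP [].
apply/dvdzP; exists (y%:Z ^+ 2 - m * (p ^ k)%N%:Z).
have pn0 : p%:Z != 0 by rewrite -lt0n.
apply: (mulfI pn0); rewrite -[LHS](subKr (x%:Z ^+ 2)) mE yE !expnS !PoszM; ring.
Qed.

(** Multiplication by [g] permutes the residues modulo [a] and carries roots of [d] to roots of
    [g ^+ 2 * d]. *)
Lemma nsqrt_sqM (a : nat) (g d : int) : (0 < a)%N -> coprimez g a ->
  nsqrt (g ^+ 2 * d) a = nsqrt d a.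
Proof.
case: a => // a _ cga.
rewrite /nsqrt !big_mkord.
have absm (z : int) : (absz (z %% a.+1)%Z)%:Z = (z %% a.+1)%Z.
  by rewrite gez0_abs // modz_ge0.
have lt z : (absz (z %% a.+1)%Z < a.+1)%N by rewrite -ltz_nat absm ltz_pmod.
pose f (x : 'I_a.+1) : 'I_a.+1 := Ordinal (lt (g * x%:Z)).
have fE (x : 'I_a.+1) : (nat_of_ord (f x))%:Z = g * x%:Z - a.+1%:Z * (g * x%:Z %/ a.+1)%Z.
  by rewrite /= absm {2}(divz_eq (g * x%:Z) a.+1); ring.
have f_inj : injective f.
  move=> x y fxy; apply: ord_inj; apply/eqP; rewrite -(dvdz_lt_eq (ltn_ord x) (ltn_ord y)).
  rewrite -(@Gauss_dvdzr _ g); last by rewrite coprimez_sym.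
  apply/dvdzP; exists ((g * x%:Z %/ a.+1)%Z - (g * y%:Z %/ a.+1)%Z).
  have := fE x; rewrite fxy fE; move: (_ %/ _)%Z (_ %/ _)%Z => k l /(canRL (subrK _)) H.
  by rewrite mulrBr H; ring.
rewrite (reindex_inj f_inj); apply: eq_bigr => x _; congr ((nat_of_bool _)%:R).
rewrite -[RHS](@Gauss_dvdzr _ (g ^+ 2)); last by rewrite coprimez_sym coprimezXl.
rewrite fE; set k := (_ %/ _)%Z.
by apply: (@dvdz_congr _ _ _ (k * (a.+1%:Z * k - 2 * g * x%:Z))); ring.
Qed.

(** * Quadratic reciprocity *)

(* This is [0] when [p] divides [u]. *)
Definition legendre (u : int) (p : nat) : int := nsqrt u p - 1.

Section OddPrime.
Variables (p : nat).
Hypotheses (pp : prime p) (po : odd p).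

Let p0 : (0 < p)%N := prime_gt0 pp.
Let P := p./2.

Let pE : p = P.*2.+1.
Proof. by rewrite /P -[LHS]odd_double_half po. Qed.

Lemma dvdz_Fp (z : int) : (p%:Z %| z)%Z = (z%:~R == 0 :> 'F_p).
Proof.
rewrite dvdzE absz_nat (dvdn_pcharf (pchar_Fp pp)).
by case: z => n //=; rewrite NegzE mulrNz oppr_eq0.
Qed.

Lemma natr_Fp_eq0 (n : nat) : (n%:R == 0 :> 'F_p) = (p %| n)%N.
Proof. by rewrite (dvdn_pcharf (pchar_Fp pp)). Qed.

Lemma expf_Fp (x : 'F_p) : x != 0 -> x ^+ P.*2 = 1.
Proof.
move=> x0; apply: (mulIf x0); rewrite mul1r -exprSr -pE.
by have := expf_card x; rewrite card_Fp.
Qed.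

Lemma two_Fp_neq0 : 2%:R != 0 :> 'F_p.
Proof. by rewrite natr_Fp_eq0; apply/negP => /dvdn_leq; move: (prime_gt1 pp); lia. Qed.

Lemma sqr_Fp_inj (x y : nat) : (0 < x <= P)%N -> (0 < y <= P)%N ->
  x%:R ^+ 2 = y%:R ^+ 2 :> 'F_p -> x = y.
Proof.
move=> xP yP /eqP; rewrite -subr_eq0 subr_sqr mulf_eq0 => /orP [|].
  have e : x%:R - y%:R = (x%:Z - y%:Z)%:~R :> 'F_p by rewrite intrB.
  rewrite e -dvdz_Fp dvdz_lt_eq; [by move/eqP|lia|lia].
by rewrite -natrD natr_Fp_eq0 => /dvdn_leq; lia.
Qed.

(** The polynomial ['X^P - 1] has at most [P] roots, and the squares of [1, ..., P] already give [P]
    distinct ones. *)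
Lemma sqrt_Fp_exists (u : 'F_p) : u ^+ P = 1 -> exists z : nat, u = z%:R ^+ 2.
Proof.
move=> uP.
pose rs := [seq (x%:R : 'F_p) ^+ 2 | x <- iota 1 P].
have [/mapP [z _ ->]|urs] := boolP (u \in rs); first by exists z.
have P0 : (0 < P)%N by move: (prime_gt1 pp); lia.
have sz : size ('X^P - 1%:P : {poly 'F_p}) = P.+1 by rewrite size_XnsubC.
have := @max_poly_roots 'F_p ('X^P - 1%:P) (u :: rs).
rewrite sz -size_poly_eq0 sz /= urs /= size_map size_iota ltnn => H.
suff: false by []; apply: H => //.
  rewrite rootE !hornerE uP subrr eqxx /=; apply/allP => _ /mapP [x + ->].
  rewrite mem_iota => xP; rewrite rootE !hornerE -exprM mul2n expf_Fp ?subrr //.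
  by rewrite natr_Fp_eq0; apply/negP => /dvdn_leq; lia.
rewrite map_inj_in_uniq ?iota_uniq // => x y; rewrite !mem_iota => xP yP.
by apply: sqr_Fp_inj; lia.
Qed.

Lemma nsqrt_residue (z : nat) : (0 < z < p)%N -> nsqrt (z%:Z ^+ 2) p = 2.
Proof.
move=> zp; rewrite /nsqrt.
rewrite (eq_big_nat _ _ (F2 := fun x => (x == z)%:R + (x == p - z)%N%:R)); last first.
  move=> x /andP [_ xp].
  rewrite dvdz_Fp subr_sqr intrM mulf_eq0 -!dvdz_Fp dvdz_lt_eq //; last by lia.
  rewrite (@dvdz_congr _ _ (x%:Z - (p - z)%N%:Z) 1); last by lia.
  rewrite dvdz_lt_eq //; last by lia.
  have : z != (p - z)%N by lia.
  by move=> zN; case: (x =P z) => [->|_] /=; rewrite ?(negbTE zN) ?addr0 ?add0r.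
rewrite big_split /= (@sum_indicator p z (fun x => x == z)) //; last by lia.
by rewrite (@sum_indicator p (p - z) (fun x => x == p - z)%N) //; lia.
Qed.

Lemma legendre_congr (u v k : int) : u - v = p%:Z * k -> legendre u p = legendre v p.
Proof. by rewrite /legendre => /nsqrt_congr ->. Qed.

(** By Fermat the power squares to 1; it is 1 exactly on squares, by [sqrt_Fp_exists], and a nonzero
    square has exactly two roots. The two cases give the integer symbol and the power in ['F_p]
    together. *)
Lemma euler_criterion (u : int) : ~~ (p%:Z %| u)%Z ->
  (legendre u p = 1 /\ u%:~R ^+ P = 1 :> 'F_p) \/
  (legendre u p = -1 /\ u%:~R ^+ P = -1 :> 'F_p).
Proof.
move=> pu; have u0 : u%:~R != 0 :> 'F_p by rewrite -dvdz_Fp.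
have [[x xE]|nx] : (exists x : nat, (p%:Z %| x%:Z ^+ 2 - u)%Z) \/
    (forall x : nat, ~~ (p%:Z %| x%:Z ^+ 2 - u)%Z).
- have [/eqP e|ne] := eqVneq (u%:~R ^+ P) (1 : 'F_p).
    left; have [|z zE] := @sqrt_Fp_exists u%:~R; first exact/eqP.
    by exists z; rewrite dvdz_Fp intrB rmorphXn /= zE subrr.
  right=> x; apply: contra ne; rewrite dvdz_Fp intrB rmorphXn /= subr_eq0 => /eqP xu.
  rewrite -xu -exprM mul2n expf_Fp //.
  by move: u0; rewrite -xu expf_eq0 /=.
- left.
  have xu : u%:~R = (x%:R : 'F_p) ^+ 2.
    by move: xE; rewrite dvdz_Fp intrB rmorphXn /= subr_eq0 => /eqP.
  have x0 : (x%:R : 'F_p) != 0 by move: u0; rewrite xu expf_eq0 /=.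
  split; last by rewrite xu -exprM mul2n expf_Fp.
  have xm : (x %% p)%N%:R = x%:R :> 'F_p by rewrite Fp_nat_mod.
  have : (p%:Z %| u - (x %% p)%N%:Z ^+ 2)%Z.
    have e : ((x %% p)%N%:Z ^+ 2)%:~R = x%:R ^+ 2 :> 'F_p by rewrite rmorphXn -xm.
    by rewrite dvdz_Fp intrB xu e subrr.
  move=> /dvdzP [k kE]; rewrite (@legendre_congr _ ((x %% p)%N%:Z ^+ 2) k); last by rewrite kE mulrC.
  rewrite /legendre nsqrt_residue // ltn_pmod // andbT lt0n.
  by apply: contra x0 => /eqP xm0; rewrite -xm xm0.
right; split.
  rewrite /legendre /nsqrt big1 ?sub0r // => x _.
  by rewrite (negbTE (nx x)).
have := expf_Fp u0; rewrite -muln2 exprM => /eqP; rewrite sqrf_eq1 => /orP [/eqP e|/eqP //].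
have [z zE] := sqrt_Fp_exists e.
by have := nx z; rewrite dvdz_Fp intrB rmorphXn /= zE subrr eqxx.
Qed.

Lemma legendre_sign (u : int) (b : nat) : ~~ (p%:Z %| u)%Z ->
  u%:~R ^+ P = (-1) ^+ b :> 'F_p -> legendre u p = (-1) ^+ b.
Proof.
have neq : (1 : 'F_p) != -1 by rewrite -subr_eq0 opprK; exact: two_Fp_neq0.
move=> pu; rewrite -!(signr_odd _ b).
case: (euler_criterion pu) => -[-> ->]; case: (odd b) => //= /eqP.
  by rewrite expr1 (negbTE neq).
by rewrite expr0 eq_sym (negbTE neq).
Qed.

Lemma legendreM (u v : int) : ~~ (p%:Z %| u)%Z -> ~~ (p%:Z %| v)%Z ->
  legendre (u * v) p = legendre u p * legendre v p.
Proof.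
move=> pu pv.
have puv : ~~ (p%:Z %| u * v)%Z by rewrite dvdz_Fp intrM mulf_eq0 -!dvdz_Fp negb_or pu.
have sgn w : ~~ (p%:Z %| w)%Z -> exists b : bool,
    legendre w p = (-1) ^+ b /\ w%:~R ^+ P = (-1) ^+ b :> 'F_p.
  by case/euler_criterion => H; [exists false|exists true].
have [a [-> aE]] := sgn u pu; have [b [-> bE]] := sgn v pv.
by rewrite -exprD; apply: legendre_sign; rewrite // intrM exprMn aE bE exprD.
Qed.

Lemma legendre_sq1 (u : int) : ~~ (p%:Z %| u)%Z -> legendre u p * legendre u p = 1.
Proof. by case/euler_criterion => -[->]. Qed.

Lemma legendreN1 : legendre (-1) p = (-1) ^+ P.
Proof. by apply: legendre_sign; rewrite ?dvdz_Fp //= mulrNz oppr_eq0 oner_eq0. Qed.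

(** The quotient [2 * a * x %/ p] is odd exactly when [a * x %% p] exceeds [P], so its parity is the
    sign relating [a * x] to [g x]. As [g] permutes [1, ..., P], multiplying these relations gives
    [a ^ P] as a product of signs. *)
Lemma gauss_lemma (a : nat) : ~~ (p %| a)%N ->
  legendre a p = (-1) ^+ (\sum_(1 <= x < P.+1) (2 * a * x) %/ p)%N.
Proof.
move=> pa; apply: legendre_sign; first by rewrite dvdzE.
pose rho x := (a * x %% p)%N.
pose g x := (if rho x <= P then rho x else p - rho x)%N.
have axE x : (a * x = a * x %/ p * p + rho x)%N by exact: divn_eq.
have rho_lt x : (rho x < p)%N by rewrite ltn_pmod.
have rho_gt0 x : (0 < x <= P)%N -> (0 < rho x)%N.
  move=> xP; rewrite lt0n; apply/negP; rewrite -/(dvdn _ _) Euclid_dvdM // (negbTE pa) /=.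
  by move/dvdn_leq; lia.
have rhoE x : (rho x)%:R = a%:R * x%:R :> 'F_p by rewrite Fp_nat_mod // natrM.
have gE x : a%:R * x%:R = (-1) ^+ (2 * a * x %/ p)%N * (g x)%:R :> 'F_p.
  have flE : (2 * a * x %/ p = (a * x %/ p).*2 + (P < rho x))%N.
    rewrite -mulnA {1}(axE x) mulnDr [(2 * (_ * p))%N]mulnA divnMDl // mul2n; congr (_ + _)%N.
    have := rho_lt x; case: (ltnP P (rho x)) => h1 h2 /=.
      rewrite (_ : 2 * rho x = 1 * p + (2 * rho x - p))%N; last by lia.
      by rewrite divnMDl // divn_small //; lia.
    by rewrite divn_small //; lia.
  rewrite flE -signr_odd oddD odd_double /= oddb -rhoE /g.
  case: leqP => _; first by rewrite mul1r.
  rewrite expr1 natrB ?(ltnW (rho_lt x)) // (eqP (_ : p%:R == 0 :> 'F_p)) ?natr_Fp_eq0 //.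
  by rewrite sub0r mulN1r opprK.
have perm_g : perm_eq (map g (iota 1 P)) (iota 1 P).
  have ug : uniq (map g (iota 1 P)).
    rewrite map_inj_in_uniq ?iota_uniq // => x y; rewrite !mem_iota => xP yP gxy.
    apply: sqr_Fp_inj; [lia|lia|].
    have a0 : (a%:R : 'F_p) ^+ 2 != 0 by rewrite expf_eq0 /= natr_Fp_eq0.
    (* Squaring removes the signs, so [g x = g y] leaves equal squares of [x] and [y] in ['F_p]. *)
    by apply: (mulfI a0); rewrite -!exprMn !gE gxy !exprMn !sqrr_sign.
  have sg : {subset map g (iota 1 P) <= iota 1 P}.
    move=> _ /mapP [x + ->]; rewrite !mem_iota => xP.
    have xP' : (0 < x <= P)%N by lia.
    have := rho_gt0 x xP'; have := rho_lt x; rewrite /g; case: (leqP (rho x) P).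
      by move: (rho x) => r; lia.
    by move: (rho x) => r; lia.
  apply: uniq_perm => //; first exact: iota_uniq.
  by have [] := uniq_min_size ug sg; rewrite ?size_map.
pose W : 'F_p := \prod_(x <- iota 1 P) x%:R.
have W0 : W != 0.
  rewrite /W prodf_seq_neq0; apply/allP => x; rewrite mem_iota natr_Fp_eq0 => xP.
  by apply/negP => /dvdn_leq; lia.
apply: (mulIf W0); rewrite -{2}(perm_big _ perm_g : _ = W) big_map /=.
rewrite [index_iota _ _](_ : _ = iota 1 P); last by rewrite /index_iota subSS subn0.
rewrite expr_sum -big_split /= (eq_bigr _ (fun x _ => esym (gE x))) big_split /=.
by rewrite big_const_seq count_predT size_iota -Monoid.iteropE.
Qed.

Lemma legendre_sq (g u : int) : ~~ (p%:Z %| g)%Z -> legendre (g ^+ 2 * u) p = legendre u p.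
Proof.
move=> pg; rewrite /legendre nsqrt_sqM // coprimezE coprime_sym prime_coprime //.
Qed.

Lemma legendre1 : legendre 1 p = 1.
Proof. by rewrite (@legendre_sign _ 0) ?dvdz_Fp ?oner_eq0 ?expr1n. Qed.

Lemma dvd2F : ~~ (p%:Z %| 2)%Z.
Proof. by rewrite dvdz_Fp; exact: two_Fp_neq0. Qed.

(* [2a] is congruent to [4b] for [b = (a + p) / 2], so Gauss's lemma applies to [b];
   the case [a = 1] evaluates [(2/p)], which then cancels. *)
Lemma eisenstein2 (a : nat) : odd a -> ~~ (p %| a)%N ->
  legendre 2 p * legendre a p =
  (-1) ^+ (\sum_(1 <= x < P.+1) (a * x) %/ p + \sum_(1 <= x < P.+1) x)%N.
Proof.
move=> ao pa; pose b := ((a + p)./2).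
have bE : (2 * b = a + p)%N by rewrite /b mul2n -[RHS]odd_double_half oddD ao po.
have pb : ~~ (p %| b)%N.
  apply: contra pa => pb; have : (p %| a + p)%N by rewrite -bE dvdn_mull.
  by rewrite dvdn_addl.
rewrite -legendreM ?dvd2F //.
rewrite (@legendre_congr _ (2 ^+ 2 * b%:Z) (-2)); last by lia.
rewrite legendre_sq ?dvd2F // gauss_lemma //; congr (_ ^+ _).
rewrite -big_split /=; apply: eq_bigr => x _.
by rewrite bE mulnDl addnC [(p * x)%N]mulnC divnMDl // addnC.
Qed.

Lemma legendre2_sum : legendre 2 p = (-1) ^+ (\sum_(1 <= x < P.+1) x)%N.
Proof.
have := @eisenstein2 1 isT; rewrite legendre1 mulr1 => -> //; last first.
  by apply/negP => /dvdn_leq; move: (prime_gt1 pp); lia.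
rewrite [X in (X + _)%N](_ : _ = 0%N) ?add0n // big_nat big1 // => x xP.
by rewrite mul1n divn_small //; lia.
Qed.

Lemma eisenstein_lemma (a : nat) : odd a -> ~~ (p %| a)%N ->
  legendre a p = (-1) ^+ (\sum_(1 <= x < P.+1) (a * x) %/ p)%N.
Proof.
move=> ao pa; have := eisenstein2 ao pa; rewrite exprD -legendre2_sum mulrC => H.
by rewrite -[LHS]mulr1 -(legendre_sq1 dvd2F) mulrA H -mulrA legendre_sq1 ?dvd2F // mulr1.
Qed.

End OddPrime.

(* The characters [(-1/n)] and [(2/n)] and the sign of the reciprocity law; they are
   meaningful only at odd arguments. *)
Definition chi4 (n : nat) : int := if (n %% 4 == 1)%N then 1 else -1.
Definition chi8 (n : nat) : int := if (n %% 8 == 1)%N || (n %% 8 == 7)%N then 1 else -1.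
Definition qr_sign (m n : nat) : int := if (m %% 4 == 3)%N && (n %% 4 == 3)%N then -1 else 1.

Lemma legendreN1E (p : nat) : prime p -> odd p -> legendre (-1) p = chi4 p.
Proof.
move=> pp po; rewrite legendreN1 // -signr_odd /chi4.
by case: eqP => h; [rewrite (_ : odd _ = false)|rewrite (_ : odd _ = true)] => //; lia.
Qed.

Lemma sum_iota_odd (P : nat) : odd (\sum_(1 <= x < P.+1) x)%N = odd (P * P.+1)./2.
Proof.
congr odd; elim: P => [|P IH]; first by rewrite big_geq.
by rewrite big_nat_recr //= IH; lia.
Qed.

(** The exponent is [P * (P + 1) / 2] with [P = p./2]; writing [p = 8 * k + 2 * c + 1] shows that
    its parity depends on [c] alone. *)
Lemma legendre2E (p : nat) : prime p -> odd p -> legendre 2 p = chi8 p.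
Proof.
move=> pp po; rewrite legendre2_sum // -signr_odd sum_iota_odd /chi8.
have [k [c [e cE]]] : exists k c, p = (8 * k + c.*2.+1)%N /\ (c < 4)%N.
  by exists (p %/ 8)%N, ((p %% 8)./2); split; lia.
have pm : (p %% 8 = c.*2.+1)%N by lia.
have -> : p./2 = (4 * k + c)%N by lia.
have -> : (((4 * k + c) * (4 * k + c).+1)./2 = 2 * (k * (4 * k + c.*2.+1)) + (c * c.+1)./2)%N.
  have : ((4 * k + c) * (4 * k + c).+1 = (2 * (k * (4 * k + c.*2.+1))).*2 + c * c.+1)%N.
    by rewrite -!mul2n; ring.
  by move=> ->; rewrite halfD odd_double doubleK.
rewrite pm oddD mul2n odd_double /=.
by case: c cE {e pm} => [|[|[|[|]]]].
Qed.

(** The quotient counts the positive multiples of [p] up to [n]. Any bound [Q] will do, so that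
    [lattice_count] can use one range of [y] for all its quotients. *)
Lemma sum_leq_divn (n p Q : nat) : (0 < p)%N -> (n %/ p <= Q)%N ->
  (n %/ p = \sum_(1 <= y < Q.+1) (p * y <= n))%N.
Proof.
move=> p0 nQ; rewrite (eq_bigr (fun y => (y <= n %/ p)%N : nat)); last first.
  by move=> y _; rewrite leq_divRL // mulnC.
move: (n %/ p)%N nQ => c; elim: Q c => [|Q IH] c cQ; first by rewrite big_geq //; lia.
rewrite big_nat_recr //=; case: (ltnP Q c) => h.
  have -> : c = Q.+1 by lia.
  rewrite big_nat (eq_bigr (fun=> 1%N)); last by move=> y yQ; rewrite (_ : _ <= _)%N //; lia.
  by rewrite -big_nat sum_nat_const_nat; lia.
by rewrite addn0 -IH.
Qed.

(** Eisenstein's rectangle: the two sums count the lattice points on either side of the line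
    [p * y = q * x], which contains none of them. *)
Lemma lattice_count (p q : nat) : prime p -> prime q -> odd p -> odd q -> p != q ->
  (\sum_(1 <= x < p./2.+1) (q * x) %/ p + \sum_(1 <= y < q./2.+1) (p * y) %/ q = p./2 * q./2)%N.
Proof.
move=> pp pq po qo npq; have p0 := prime_gt0 pp; have q0 := prime_gt0 pq.
have half (r s x : nat) : prime r -> odd r -> odd s -> (0 < x < r./2.+1)%N ->
    ((s * x) %/ r <= s./2)%N.
  move=> pr ro so xr; rewrite -ltnS ltn_divLR ?prime_gt0 //.
  have -> : r = r./2.*2.+1 by lia.
  have : s = s./2.*2.+1 by lia.
  by move: s./2 r./2 xr => S R xr ->; nia.
rewrite (eq_big_nat _ _ (fun x h => sum_leq_divn p0 (half p q x pp po qo h))).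
rewrite (eq_big_nat _ _ (fun x h => sum_leq_divn q0 (half q p x pq qo po h))).
rewrite [X in (_ + X)%N]exchange_big /= -big_split /=.
rewrite big_nat (eq_bigr (fun=> q./2)).
  by rewrite -big_nat sum_nat_const_nat subSS subn0.
move=> x xP; rewrite -big_split /= big_nat (eq_bigr (fun=> 1%N)).
  by rewrite -big_nat sum_nat_const_nat subSS subn0 muln1.
move=> y yQ; have : (p * y != q * x)%N; last by lia.
apply/eqP => e; have : (p %| q * x)%N by rewrite -e dvdn_mulr.
rewrite Euclid_dvdM // dvdn_prime2 // (negbTE npq) /= => /dvdn_leq; lia.
Qed.

Lemma quadratic_reciprocity (p q : nat) : prime p -> prime q -> odd p -> odd q -> p != q ->
  legendre q p = qr_sign p q * legendre p q.
Proof.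
move=> pp pq po qo npq.
have pNq : ~~ (p %| q)%N by rewrite dvdn_prime2.
have qNp : ~~ (q %| p)%N by rewrite dvdn_prime2 // eq_sym.
have sq : legendre p q * legendre p q = 1 by rewrite legendre_sq1 // dvdzE.
rewrite -[LHS]mulr1 -sq mulrA; congr (_ * _).
rewrite !eisenstein_lemma // -exprD lattice_count // -signr_odd oddM /qr_sign.
have h r : odd r -> odd r./2 = (r %% 4 == 3)%N by lia.
by rewrite !h //; case: (_ == _)%N; case: (_ == _)%N.
Qed.

(** * Jacobi symbols and sums over pairs of disjoint sets of primes *)

(** Odd squarefree integers are carried as lists of primes: [lprod] gives the integer, and
    [jacobi u e] is the Jacobi symbol of [u] over [lprod e]. *)
Definition lprod (s : seq nat) : nat := (\prod_(p <- s) p)%N.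
Definition jacobi (u : int) (e : seq nat) : int := \prod_(p <- e) legendre u p.
Definition oprime (p : nat) := prime p && odd p.

Lemma lprod_cons p s : lprod (p :: s) = (p * lprod s)%N.
Proof. exact: big_cons. Qed.

Lemma jacobi_cons u p e : jacobi u (p :: e) = legendre u p * jacobi u e.
Proof. exact: big_cons. Qed.

Lemma prime_dvd_lprod (p : nat) (s : seq nat) : prime p -> all oprime s ->
  (p %| lprod s)%N = (p \in s).
Proof.
move=> pp; elim: s => [|q s IH] /=; first by rewrite /lprod big_nil Euclid_dvd1.
move=> /andP [/andP [pq _] /IH sE]; rewrite lprod_cons Euclid_dvdM // sE inE.
by rewrite dvdn_prime2.
Qed.

Lemma odd_lprod (s : seq nat) : all oprime s -> odd (lprod s).
Proof.
elim: s => [|p s IH]; first by rewrite /lprod big_nil.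
by rewrite lprod_cons oddM /= => /andP [/andP [_ ->] /IH].
Qed.

Lemma dvdz_primeM (p : nat) (u v : int) : prime p ->
  (p%:Z %| u * v)%Z = (p%:Z %| u)%Z || (p%:Z %| v)%Z.
Proof. by move=> pp; rewrite !dvdzE abszM Euclid_dvdM. Qed.

Lemma jacobiM (u v : int) (e : seq nat) : all oprime e ->
  all (fun p => ~~ (p%:Z %| u)%Z) e -> all (fun p => ~~ (p%:Z %| v)%Z) e ->
  jacobi (u * v) e = jacobi u e * jacobi v e.
Proof.
elim: e => [|p e IH]; first by rewrite /jacobi !big_nil.
move=> /= /andP [/andP [pp po] oe] /andP [pu eu] /andP [pv ev].
by rewrite !jacobi_cons IH // legendreM //; ring.
Qed.

Lemma jacobi_sqM (g u : int) (e : seq nat) : all oprime e ->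
  all (fun p => ~~ (p%:Z %| g)%Z) e -> jacobi (g ^+ 2 * u) e = jacobi u e.
Proof.
elim: e => [|p e IH]; first by rewrite /jacobi !big_nil.
move=> /= /andP [/andP [pp po] oe] /andP [pg eg].
by rewrite !jacobi_cons IH // legendre_sq.
Qed.

Lemma mod8_odd (n : nat) : odd n -> (n %% 8 \in [:: 1; 3; 5; 7])%N.
Proof. by move=> no; rewrite !inE; lia. Qed.

Lemma chi4_mod8 n : chi4 (n %% 8) = chi4 n.
Proof. by rewrite /chi4 modn_dvdm. Qed.

Lemma chi8_mod8 n : chi8 (n %% 8) = chi8 n.
Proof. by rewrite /chi8 modn_mod. Qed.

Lemma qr_sign_mod8 m n : qr_sign (m %% 8) (n %% 8) = qr_sign m n.
Proof. by rewrite /qr_sign !modn_dvdm. Qed.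

Lemma chi4M m n : odd m -> odd n -> chi4 (m * n) = chi4 m * chi4 n.
Proof.
move=> /mod8_odd mo /mod8_odd no; rewrite -chi4_mod8 -modnMm -[chi4 m]chi4_mod8 -[chi4 n]chi4_mod8.
move: (m %% 8)%N (n %% 8)%N mo no => i j; rewrite !inE.
by move=> /or4P [] /eqP -> /or4P [] /eqP ->.
Qed.

Lemma chi8M m n : odd m -> odd n -> chi8 (m * n) = chi8 m * chi8 n.
Proof.
move=> /mod8_odd mo /mod8_odd no; rewrite -chi8_mod8 -modnMm -[chi8 m]chi8_mod8 -[chi8 n]chi8_mod8.
move: (m %% 8)%N (n %% 8)%N mo no => i j; rewrite !inE.
by move=> /or4P [] /eqP -> /or4P [] /eqP ->.
Qed.

Lemma qr_signM m n l : odd m -> odd n -> qr_sign (m * n) l = qr_sign m l * qr_sign n l.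
Proof.
move=> mo no; have : chi4 (m * n) = chi4 m * chi4 n by apply: chi4M.
have e3 i : odd i -> (i %% 4 == 3)%N = (chi4 i == -1).
  move=> io; rewrite /chi4; case: (i %% 4 =P 1)%N => [-> //|h].
  by rewrite eqxx; lia.
rewrite /qr_sign (e3 (m * n)%N) ?oddM ?mo ?no // (e3 m) // (e3 n) // => ->.
by rewrite /chi4; case: (m %% 4 == 1)%N; case: (n %% 4 == 1)%N; case: (l %% 4 == 3)%N.
Qed.

Lemma qr_signC m n : qr_sign m n = qr_sign n m.
Proof. by rewrite /qr_sign andbC. Qed.

Lemma jacobiN1 e : all oprime e -> jacobi (-1) e = chi4 (lprod e).
Proof.
elim: e => [|p e IH]; first by rewrite /jacobi /lprod !big_nil.
move=> /= /andP [/andP [pp po] oe].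
by rewrite jacobi_cons lprod_cons chi4M ?odd_lprod // IH // legendreN1E.
Qed.

Lemma jacobi2 e : all oprime e -> jacobi 2 e = chi8 (lprod e).
Proof.
elim: e => [|p e IH]; first by rewrite /jacobi /lprod !big_nil.
move=> /= /andP [/andP [pp po] oe].
by rewrite jacobi_cons lprod_cons chi8M ?odd_lprod // IH // legendre2E.
Qed.

(** Induction on [m]: [qr_sign] is multiplicative in each argument, so the signs from the single
    primes multiply up. *)
Lemma jacobi_prime (p : nat) (m : seq nat) : oprime p -> all oprime m -> p \notin m ->
  legendre (lprod m) p = qr_sign p (lprod m) * jacobi p m.
Proof.
move=> /andP [pp po]; elim: m => [|q m IH] /=.
  by move=> *; rewrite /lprod /jacobi !big_nil legendre1 // /qr_sign andbF.
move=> /andP [/andP [pq qo] om]; rewrite inE negb_or => /andP [npq pm].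
rewrite lprod_cons PoszM legendreM //; last first.
- by rewrite dvdzE prime_dvd_lprod.
- by rewrite dvdzE dvdn_prime2.
rewrite IH // jacobi_cons quadratic_reciprocity // [qr_sign p (_ * _)]qr_signC qr_signM ?odd_lprod //.
by rewrite [qr_sign p q]qr_signC [qr_sign p (lprod m)]qr_signC; ring.
Qed.

Lemma jacobi_reciprocity (e m : seq nat) : all oprime (e ++ m) -> uniq (e ++ m) ->
  jacobi (lprod m) e = qr_sign (lprod e) (lprod m) * jacobi (lprod e) m.
Proof.
elim: e => [|p e IH] /=.
  move=> om _; have -> : lprod [::] = 1%N by exact: big_nil.
  rewrite /qr_sign mul1r /jacobi big_nil.
  rewrite big1_seq // => q /andP [_ qm]; apply: legendre1; move: (allP om q qm) => /andP [] //.
rewrite all_cat mem_cat negb_or => /and3P [op oe om] /andP [/andP [pe pm] u].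
rewrite jacobi_cons lprod_cons IH ?all_cat ?oe // jacobi_prime // PoszM jacobiM //.
- move: op => /andP [pp po]; rewrite qr_signM ?odd_lprod //; ring.
- apply/allP => q qm; move: (allP om q qm) => /andP [pq _]; move: op => /andP [pp _].
  by rewrite dvdzE !absz_nat dvdn_prime2 //; apply: contraNneq pm => <-.
apply/allP => q qm; move: (allP om q qm) => /andP [pq _].
rewrite dvdzE prime_dvd_lprod //; apply: contraTN u => qe.
rewrite cat_uniq negb_and; apply/orP; right; rewrite negb_and; apply/orP; left.
by rewrite negbK; apply/hasP; exists q.
Qed.

(** * Sums over ordered pairs of disjoint sublists *)

Section Pairs.
Variables A B : nat -> int.

(* The sum of [f e m] over ordered pairs of disjoint sublists [e], [m] of [s],
   weighted by [B p] for each [p] in [e] or [m] and by [A p] for each other [p]. *)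
Fixpoint pair_sum (s : seq nat) (f : seq nat -> seq nat -> int) : int :=
  if s is p :: s' then
    pair_sum s' (fun e m => A p * f e m + B p * (f (p :: e) m + f e (p :: m)))
  else f [::] [::].

(** The recursion puts each element of [s] in at most one of the lists, so a summand matters only on
    disjoint repetition-free lists. This is how coprimality reaches the later computations. *)
Lemma eq_pair_sum (s : seq nat) (f g : seq nat -> seq nat -> int) : uniq s ->
  (forall e m, uniq (e ++ m) -> {subset e ++ m <= s} -> f e m = g e m) ->
  pair_sum s f = pair_sum s g.
Proof.
elim: s f g => [|p s IH] f g /=; first by move=> _ ->.
move=> /andP [ps us] fg; apply: IH => // e m uem sem.
have pem : p \notin e ++ m by apply: contra ps => /sem.
have uc : uniq (p :: e ++ m) by rewrite /= pem.
have pE : perm_eq (e ++ p :: m) (p :: e ++ m) by rewrite -cat1s perm_catCA.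
have sc : {subset p :: e ++ m <= p :: s}.
  by move=> x; rewrite !inE => /orP [->//|/sem ->]; rewrite orbT.
congr (_ * _ + _ * (_ + _)); apply: fg => //.
- by move=> x /sem xs; rewrite inE xs orbT.
- by rewrite (perm_uniq pE).
- by move=> x; rewrite (perm_mem pE) => /sc.
Qed.

Lemma ext_pair_sum s h h' : (forall e m, h e m = h' e m) -> pair_sum s h = pair_sum s h'.
Proof.
elim: s h h' => [|q s IH] h h' hh /=; first exact: hh.
by apply: IH => e m; rewrite !hh.
Qed.

Lemma pair_sumD s f g : pair_sum s (fun e m => f e m + g e m) = pair_sum s f + pair_sum s g.
Proof.
elim: s f g => [|p s IH] f g //=; rewrite -IH.
by apply: ext_pair_sum => e m; ring.
Qed.

Lemma pair_sumZ s c f : pair_sum s (fun e m => c * f e m) = c * pair_sum s f.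
Proof.
elim: s f => [|p s IH] f //=; rewrite -IH; apply: ext_pair_sum => e m; ring.
Qed.

Lemma pair_sum0 s : pair_sum s (fun _ _ => 0) = 0.
Proof.
elim: s => [|p s IH] //=; rewrite -[RHS]IH; apply: ext_pair_sum => e m.
by rewrite addr0 !mulr0 addr0.
Qed.

Lemma pair_sum_big s (k : nat) (f : nat -> seq nat -> seq nat -> int) :
  \sum_(0 <= j < k) pair_sum s (f j) = pair_sum s (fun e m => \sum_(0 <= j < k) f j e m).
Proof.
elim: k => [|k IH].
  rewrite big_geq // -[LHS](pair_sum0 s); apply: ext_pair_sum => e m; rewrite big_geq //.
rewrite big_nat_recr //= IH -pair_sumD; apply: ext_pair_sum => e m.
by rewrite big_nat_recr.
Qed.

(** [B p] weights both placements of [p] equally. *)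
Lemma pair_sum_swap s f : pair_sum s f = pair_sum s (fun e m => f m e).
Proof.
elim: s f => [|p s IH] f //=; rewrite IH; apply: ext_pair_sum => e m.
by congr (_ + _ * _); rewrite addrC.
Qed.

End Pairs.

(** * Local sums at an odd prime *)

Fixpoint weight0 (p k : nat) : int :=
  match k with 0%N | 1%N => 1 | 2%N | 3%N => 2 | k'.+4 => p%:Z * weight0 p k' + 2 end.
Fixpoint weight1 (p k : nat) : int :=
  match k with 0%N => 0 | 1%N | 2%N | 3%N => 1 | k'.+4 => p%:Z * weight1 p k' + 1 end.

Lemma nsqrt_unit (p k : nat) (u : int) : prime p -> odd p -> ~~ (p%:Z %| u)%Z ->
  nsqrt u (p ^ k.+1) = 1 + legendre u p.
Proof.
move=> pp po pu; elim: k => [|k <-]; last exact: nsqrt_hensel.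
by rewrite expn1 /legendre addrC subrK.
Qed.

(** [x] and [y] stand for the contribution of the remaining primes at even and odd [j]. On the
    right, [p] joins neither list in the [weight0] term; in the [weight1] term it joins the first
    list ([legendre u p * x]) or the second ([y]). *)
Lemma local_sum (p k : nat) (u x y : int) : prime p -> odd p -> ~~ (p%:Z %| u)%Z ->
  \sum_(0 <= j < k.+1) nsqrt (p%:Z ^+ j * u) (p ^ (k - j)) * (if odd j then y else x)
    = weight0 p k * x + weight1 p k * (legendre u p * x + y).
Proof.
move=> pp po pu.
have d1 j v : nsqrt (p%:Z ^+ j.+1 * v) p = 1.
  by rewrite nsqrt_dvd // -[(p%:Z %| _)%Z]/(_) exprS -mulrA dvdz_mulr.
have n0 v : nsqrt v (p ^ 0) = 1 by rewrite expn0 nsqrt1.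
have r0 i : nsqrt (p%:Z * u) (p ^ i.+2) = 0 by exact: nsqrt_ramified.
(* Dividing [p ^ 2] out of discriminant and modulus turns the inner terms into [p] times the sum for
   [k]. Of the four outer terms, [j = 0] gives [(1 + legendre u p) * x], [j = 1] gives 0 and the
   last two give [x + y]; hence the recursion in steps of four. *)
have step : forall k,
  \sum_(0 <= j < k.+1) nsqrt (p%:Z ^+ j * u) (p ^ (k - j)) * (if odd j then y else x)
    = weight0 p k * x + weight1 p k * (legendre u p * x + y) ->
  \sum_(0 <= j < k.+4.+1) nsqrt (p%:Z ^+ j * u) (p ^ (k.+4 - j)) * (if odd j then y else x)
    = weight0 p k.+4 * x + weight1 p k.+4 * (legendre u p * x + y).
  move=> {}k IH.
  rewrite big_nat_recr //= big_nat_recr //= 2?big_nat_recl //=.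
  rewrite (eq_big_nat _ _ (F2 := fun j =>
    p%:Z * (nsqrt (p%:Z ^+ j * u) (p ^ (k - j)) * (if odd j then y else x)))); last first.
    move=> j jk; rewrite negbK !subSS -addn2 exprD -mulrA [_ * (_ * u)]mulrCA.
    rewrite (_ : k.+2 - j = 2 + (k - j))%N; last by lia.
    by rewrite expnD nsqrt_sq_scale // mulrA.
  rewrite -mulr_sumr IH subnn n0 subSnn expn1 d1 !negbK.
  rewrite subn0 expr0 mul1r nsqrt_unit // expr1 subSS subn0 r0.
  by case: (odd k); rewrite /=; ring.
elim/ltn_ind: k => -[|[|[|[|k]]]] IH; last by apply: step; apply: IH; lia.
- rewrite big_nat1 subnn n0 /=; ring.
- rewrite big_nat_recr //= big_nat1 /= subn0 expr0 mul1r nsqrt_unit // subnn n0; ring.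
- rewrite 2?big_nat_recr //= big_nat1 /= subn0 expr0 mul1r nsqrt_unit // subnn n0.
  rewrite expn1 d1; ring.
rewrite 3?big_nat_recr //= big_nat1 /= subn0 expr0 mul1r nsqrt_unit // subnn n0.
rewrite expn1 d1 expr1 r0; ring.
Qed.

(** * Odd part *)

(** The index [j] is the exponent of [p] in the complementary divisor, since that is the power of
    [p] entering the discriminant. *)
Lemma sum_divisors_primeX (p k N : nat) (F : nat -> nat -> int) :
  prime p -> (0 < N)%N -> ~~ (p %| N)%N ->
  \sum_(a <- divisors (p ^ k * N)) F a (p ^ k * N %/ a)%N =
  \sum_(0 <= j < k.+1) \sum_(a <- divisors N) F (p ^ (k - j) * a)%N (p ^ j * (N %/ a))%N.
Proof.
move=> pp N0 pN; have p0 := prime_gt0 pp.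
have pkN : (0 < p ^ k * N)%N by rewrite muln_gt0 expn_gt0 p0.
have pa a : a \in divisors N -> ~~ (p %| a)%N.
  by rewrite -dvdn_divisors // => aN; apply: contra pN => /dvdn_trans ->.
have logE i a : a \in divisors N -> logn p (p ^ i * a) = i.
  move=> aN; have a0 : (0 < a)%N by apply: (dvdn_gt0 N0); rewrite dvdn_divisors.
  rewrite lognM ?expn_gt0 ?p0 // pfactorK // lognE (negbTE (pa a aN)) !andbF addn0 //.
have peq : perm_eq (divisors (p ^ k * N))
    [seq (p ^ (k - j) * a)%N | j <- index_iota 0 k.+1, a <- divisors N].
  apply: uniq_perm; first exact: divisors_uniq.
    apply: allpairs_uniq; [exact: iota_uniq|exact: divisors_uniq|].
    move=> [i a] [j b] /allpairsPdep [i1 [a1 [ik aN [-> ->]]]].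
    move=> /allpairsPdep [j1 [b1 [jk bN [-> ->]]]] /= e.
    move: {i a j b} i1 a1 j1 b1 ik aN jk bN e => i a j b ik aN jk bN e.
    have := congr1 (logn p) e; rewrite !logE // => ij.
    move: ik jk; rewrite !mem_index_iota => ik jk.
    have {}ij : i = j by lia.
    subst j; move: e => /eqP; rewrite eqn_pmul2l ?expn_gt0 ?p0 //.
    by move=> /eqP ->.
  move=> x; rewrite -dvdn_divisors //; apply/idP/allpairsP => [xd|].
    have x0 : (0 < x)%N by exact: dvdn_gt0 pkN xd.
    have [m cpm xE] := pfactor_coprime pp x0.
    set l := logn p x in xE.
    have lk : (l <= k)%N.
      have := dvdn_leq_log p pkN xd; rewrite -/l logE //.
      by rewrite -dvdn_divisors.
    exists ((k - l)%N, m) => /=; split; rewrite ?mem_index_iota; first by lia.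
      rewrite -dvdn_divisors // -(@Gauss_dvdr m (p ^ k)) ?coprimeXr 1?coprime_sym //.
      by apply: dvdn_trans xd; rewrite xE dvdn_mulr.
    by rewrite subKn // xE mulnC.
  move=> [[j a] /= [jk aN ->]]; apply: dvdn_mul; last by rewrite dvdn_divisors.
  by apply: dvdn_exp2l; lia.
rewrite (perm_big _ peq) big_allpairs_dep /= big_seq [RHS]big_seq; apply: eq_bigr => j.
rewrite mem_index_iota => jk; rewrite big_seq [RHS]big_seq; apply: eq_bigr => a.
rewrite -dvdn_divisors // => aN; congr (F _ _).
have -> : (p ^ k = p ^ (k - j) * p ^ j)%N by rewrite -expnD subnK //; lia.
rewrite -mulnA divnMl ?expn_gt0 ?p0 // muln_divA //.
Qed.

(** [c] and [h] are general so that the induction can absorb a prime: splitting off [p] multiplies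
    [c] by [p ^ j] and moves the root count modulo the power of [p] into [h]. The new [h] keeps its
    invariance under squares by [nsqrt_sqM]. *)
Lemma sum_divisors_odd (s : seq nat) (k : nat -> nat) (c : int) (h : nat -> int) :
  all oprime s -> uniq s -> (forall p, p \in s -> ~~ (p%:Z %| c)%Z) ->
  (forall p d, p \in s -> h (p ^ 2 * d)%N = h d) ->
  let N := (\prod_(p <- s) p ^ k p)%N in
  \sum_(a <- divisors N) h (N %/ a)%N * nsqrt (c * (N %/ a)%N%:Z) a =
  pair_sum (fun p => weight0 p (k p)) (fun p => weight1 p (k p)) s
    (fun e m => h (lprod m) * jacobi (c * (lprod m)%:Z) e).
Proof.
elim: s c h => [|p s IH] c h /=.
  by move=> *; rewrite big_nil big_seq1 divn1 nsqrt1 /jacobi /lprod !big_nil.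
move=> /andP [/andP [pp po] os] /andP [ps us] pc hs; have p0 := prime_gt0 pp.
have pcp : ~~ (p%:Z %| c)%Z by apply: pc; rewrite mem_head.
set N := (\prod_(q <- s) q ^ k q)%N.
have N0 : (0 < N)%N.
  rewrite /N big_seq prodn_cond_gt0 // => q qs; rewrite expn_gt0 prime_gt0 //.
  by case/andP: (allP os q qs).
have pN : ~~ (p %| N)%N.
  rewrite /N; apply/negP => pN; case/negP: ps.
  move: pN os; clear -pp; elim: s => [|q s IH]; first by rewrite big_nil Euclid_dvd1.
  rewrite big_cons Euclid_dvdM // => dv /= /andP [/andP [pq _] os]; case/orP: dv => [|/IH H].
    by rewrite Euclid_dvdX // dvdn_prime2 // => /andP [/eqP -> _]; rewrite mem_head.
  by rewrite inE H // orbT.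
rewrite big_cons -/N (@sum_divisors_primeX p (k p) N (fun a d => h d * nsqrt (c * d%:Z) a)) //.
rewrite (eq_big_nat _ _ (F2 := fun j =>
   pair_sum (fun p => weight0 p (k p)) (fun p => weight1 p (k p)) s
   (fun e m => h (p ^ j * lprod m)%N * nsqrt (c * (p ^ j * lprod m)%N%:Z) (p ^ (k p - j))
     * jacobi (c * (p ^ j)%N%:Z * (lprod m)%:Z) e))); last first.
  move=> j jk.
  rewrite -(IH (c * (p ^ j)%N%:Z)
    (fun d => h (p ^ j * d)%N * nsqrt (c * (p ^ j * d)%N%:Z) (p ^ (k p - j)))) //.
  - rewrite big_seq [RHS]big_seq; apply: eq_bigr => a; rewrite -dvdn_divisors // => aN.
    rewrite nsqrtM ?expn_gt0 ?p0 //.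
    + by rewrite -/N PoszM !mulrA.
    + exact: dvdn_gt0 N0 aN.
    + by rewrite coprimeXl // prime_coprime //; apply: contra pN => /dvdn_trans ->.
  - move=> q qs; have /andP [pq _] := allP os q qs.
    rewrite dvdz_primeM // negb_or pc ?inE ?qs ?orbT // dvdzE !absz_nat Euclid_dvdX //.
    by rewrite dvdn_prime2 // negb_and; apply/orP; left; apply: contraNneq ps => <-.
  - move=> q d qs; have /andP [pq _] := allP os q qs.
    rewrite mulnCA hs ?inE ?qs ?orbT //; congr (_ * _).
    rewrite PoszM mulrCA -[(q ^ 2)%N]mulnn PoszM -expr2 nsqrt_sqM ?expn_gt0 ?p0 //.
    rewrite coprimezE !absz_nat coprimeXr // prime_coprime // dvdn_prime2 //.
    by apply: contraNneq ps => <-.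
rewrite pair_sum_big; apply: eq_pair_sum => // e m uem sem.
have oe : all oprime e by apply/allP => q qe; apply: (allP os); apply: sem; rewrite mem_cat qe.
have om : all oprime m by apply/allP => q qe; apply: (allP os); apply: sem; rewrite mem_cat qe orbT.
have pm : p \notin m by apply: contra ps => pm; apply: sem; rewrite mem_cat pm orbT.
have pe : p \notin e by apply: contra ps => pe; apply: sem; rewrite mem_cat pe.
have pcm : ~~ (p%:Z %| c * (lprod m)%:Z)%Z.
  by rewrite dvdz_primeM // negb_or pcp dvdzE !absz_nat prime_dvd_lprod.
have epe : all (fun q : nat => ~~ (q%:Z %| p%:Z)%Z) e.
  apply/allP => q qe; have /andP [pq _] := allP oe q qe.
  by rewrite dvdzE !absz_nat dvdn_prime2 //; apply: contraNneq pe => <-.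
pose x := h (lprod m) * jacobi (c * (lprod m)%:Z) e.
pose y := h (lprod (p :: m)) * jacobi (c * (lprod (p :: m))%:Z) e.
(* Factors [p ^ 2] drop out of [h] and of the symbol, so only the parity of [j] matters. *)
have term j : h (p ^ j * lprod m)%N * jacobi (c * (p ^ j)%N%:Z * (lprod m)%:Z) e =
    if odd j then y else x.
  elim/ltn_ind: j => -[|[|j]] IHj.
  - by rewrite expn0 mul1n mulr1.
  - by rewrite /= expn1 /y lprod_cons PoszM mulrA.
  - rewrite /= negbK -IHj; last by lia.
    rewrite -addn2 addnC expnD -mulnA hs ?mem_head //; congr (_ * _).
    rewrite -mulnn !PoszM -expr2.
    by rewrite -[c * _ * _]mulrA -[p%:Z ^+ 2 * _ * _]mulrA mulrCA jacobi_sqM // mulrA.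
rewrite (eq_bigr (fun j => nsqrt (p%:Z ^+ j * (c * (lprod m)%:Z)) (p ^ (k p - j)) *
    (if odd j then y else x))).
  by rewrite local_sum // jacobi_cons /x /y; ring.
move=> j _; rewrite -term mulrAC mulrC; congr (nsqrt _ _ * _).
have -> : (p ^ j * lprod m)%N%:Z = p%:Z ^+ j * (lprod m)%:Z.
  by rewrite PoszM -natz natrX natz.
by rewrite mulrCA.
Qed.

(** * The prime 2 *)

(* The number of square roots of [2^j u] modulo [2^i], for odd [u] congruent to [v]
   modulo 8; see [nsqrt_pow2E]. *)
Fixpoint nsqrt2 (i j v : nat) : int :=
  match i, j with
  | 0%N, _ | 1%N, _ => 1
  | 2%N, 0%N => if (v %% 4 == 1)%N then 2 else 0
  | _, 0%N => if (v == 1)%N then 4 else 0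
  | _, 1%N => 0
  | i'.+2, j'.+2 => 2 * nsqrt2 i' j' v
  end.

Lemma nsqrt_pow2E (i j v : nat) (u : int) : ~~ (2 %| u)%Z -> (u %% 8)%Z = v ->
  nsqrt (2 ^+ j * u) (2 ^ i) = nsqrt2 i j v.
Proof.
move=> u2 uv; elim/ltn_ind: i j => -[|[|i]] IH j.
- by rewrite nsqrt1; case: j.
- have e : 2 ^+ j * u - ((2 ^+ j * u) %% 2)%Z = 2%N%:Z * ((2 ^+ j * u) %/ 2)%Z.
    by rewrite {1}(divz_eq (2 ^+ j * u) 2); ring.
  rewrite expn1 (nsqrt_congr e) /=.
  have [->|->] : ((2 ^+ j * u) %% 2)%Z = 0 \/ ((2 ^+ j * u) %% 2)%Z = 1 by lia.
    by rewrite /nsqrt unlock; case: j {e}.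
  by rewrite /nsqrt unlock; case: j {e}.
case: j => [|[|j]].
- rewrite expr0 mul1r; case: i IH => [|i] _; last first.
    by rewrite nsqrt_pow2 // uv; case: v uv => [|[|v]].
  have e : u - (u %% 4)%Z = (2 ^ 2)%N%:Z * (u %/ 4)%Z by rewrite {1}(divz_eq u 4); ring.
  rewrite (nsqrt_congr e) /=.
  have [[-> v4]|[-> v4]] :
    ((u %% 4)%Z = 1 /\ (v %% 4 = 1)%N) \/ ((u %% 4)%Z = 3 /\ (v %% 4 = 3)%N) by lia.
    by rewrite v4 /nsqrt unlock.
  by rewrite v4 /nsqrt unlock.
- by rewrite expr1 nsqrt_ramified //; case: i {IH}.
rewrite (_ : 2 ^+ j.+2 * u = 2%N%:Z ^+ 2 * (2 ^+ j * u)); last by rewrite !exprS; ring.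
by rewrite -(addn2 i) addnC expnD nsqrt_sq_scale // IH // addnC addn2; case: i {IH}.
Qed.

(* The 2-adic factor at [|n| = 2^k N] for roots modulo [2^t a], with [b] the sign
   of the discriminant; [7] stands for [-1] modulo 8. *)
Definition local2 (t k : nat) (b : bool) (E M : nat) : int :=
  (if b then chi4 E else 1) *
  \sum_(0 <= j < k.+1) nsqrt2 (t + (k - j)) j ((if b then 7 else 1) * M %% 8) * chi8 E ^+ j.

Lemma local2_mod8 t k b E M : local2 t k b (E %% 8) (M %% 8) = local2 t k b E M.
Proof. by rewrite /local2 chi4_mod8 chi8_mod8 modnMmr. Qed.

Lemma chi8_sq n : chi8 n ^+ 2 = 1.
Proof. by rewrite /chi8; case: ifP. Qed.

(** The recursion of [local_sum] at the prime 2. The term [j = 0] gives the 4 or 0, [j = 1] gives 0,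
    and the last two, with moduli [2 ^ t.+1] and [2 ^ t], give the multiple of [1 + chi8 E]. *)
Lemma local2_step t k b E M : t \in [:: 0; 2]%N ->
  local2 t k.+4 b E M = 2 * local2 t k b E M + (if b then chi4 E else 1) *
   ((if ((if b then 7 else 1) * M %% 8 == 1)%N then 4 else 0)
    + (if t == 0%N then 1 else 2) * (1 + chi8 E)).
Proof.
move=> tE; rewrite /local2; set v := (_ %% 8)%N; set sg := if b then chi4 E else 1.
rewrite big_nat_recr //= big_nat_recr //= 2?big_nat_recl //=.
rewrite (eq_big_nat _ _ (F2 := fun j => 2 * (nsqrt2 (t + (k - j)) j v * chi8 E ^+ j))); last first.
  move=> j jk; rewrite !subSS (_ : t + (k.+2 - j) = (t + (k - j)).+2)%N; last by lia.
  have -> : chi8 E ^+ j.+2 = chi8 E ^+ j by rewrite -addn2 exprD chi8_sq mulr1.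
  by rewrite mulrA; congr (_ * _); case: (t + (k - j))%N.
rewrite -mulr_sumr subnn subSnn subn0 subSS subn0.
have eE : chi8 E ^+ k.+3 + chi8 E ^+ k.+4 = 1 + chi8 E.
  have [->|->] : chi8 E = 1 \/ chi8 E = -1 by rewrite /chi8; case: ifP; [left|right].
    by rewrite !expr1n.
  by rewrite [_ ^+ k.+4]exprS mulN1r !subrr.
have -> : nsqrt2 (t + k.+4) 0 v = if v == 1%N then 4 else 0 by rewrite !addnS.
have -> : nsqrt2 (t + k.+3) 1 v = 0 by rewrite !addnS.
have [-> ->] : nsqrt2 (t + 1) k.+3 v = (if t == 0%N then 1 else 2) /\
    nsqrt2 (t + 0) k.+4 v = (if t == 0%N then 1 else 2).
  by move: tE; rewrite !inE => /orP [] /eqP -> /=; rewrite ?mulr1.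
by rewrite -eE expr0; ring.
Qed.

(** [defect1] and [defect2] are the left side minus the right side of the two identities in
    [sqrt_sum_reflection], at the level of 2-adic factors. *)
Definition defect1 k E M : int :=
  2 * local2 0 k false E M - local2 2 k false E M - local2 2 k true E M.
Definition defect2 k E M : int :=
  local2 0 k false E M + local2 0 k true E M - local2 2 k false E M.

(** The defects themselves need not vanish: [defect1 0] is 4 when [E] and [M] are both 3 modulo 4,
    and only the sign -1 of reciprocity cancels it. All terms depend on [E] and [M] modulo 8, so
    [k < 4] is a finite evaluation and larger [k] follow by [local2_step]. *)
Lemma defect_antisym (k E M : nat) : odd E -> odd M ->
  defect1 k E M + qr_sign E M * defect1 k M E = 0 /\
  defect2 k E M + qr_sign E M * defect2 k M E = 0.
Proof.
move=> /mod8_odd + /mod8_odd; rewrite /defect1 /defect2.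
do ![rewrite -(local2_mod8 _ _ _ E M)]; do ![rewrite -(local2_mod8 _ _ _ M E)].
rewrite -qr_sign_mod8.
move: (E %% 8)%N (M %% 8)%N => {}E {}M Eo Mo.
elim/ltn_ind: k => -[|[|[|[|k]]]] IH.
1-4: by move: Eo Mo; rewrite !inE => /or4P [] /eqP -> /or4P [] /eqP ->;
  rewrite /local2 unlock; split; vm_compute.
rewrite !local2_step //; have [|] := IH k; first by lia.
(* The old local factors become variables: each new defect is twice the old one plus a term fixed by
   the residues, so the goal is linear in the hypotheses. *)
move: (local2 0 k false E M) (local2 0 k true E M) (local2 2 k false E M) (local2 2 k true E M)
  (local2 0 k false M E) (local2 0 k true M E) (local2 2 k false M E) (local2 2 k true M E).
move=> x1 x2 x3 x4 y1 y2 y3 y4 {IH}.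
move: Eo Mo; rewrite !inE => /or4P [] /eqP -> /or4P [] /eqP ->;
  rewrite /qr_sign /chi4 /chi8 /=; lia.
Qed.

(** The sum is added to its copy with [e] and [m] exchanged; after reciprocity each summand is a
    multiple of an expression assumed to be 0. *)
Lemma pair_sum_antisym A B s (f : nat -> nat -> int) : all oprime s -> uniq s ->
  (forall E M, odd E -> odd M -> f E M + qr_sign E M * f M E = 0) ->
  pair_sum A B s (fun e m => f (lprod e) (lprod m) * jacobi (lprod m) e) = 0.
Proof.
move=> os us fE; set F := fun e m => _.
suff : pair_sum A B s F + pair_sum A B s F = 0 by lia.
rewrite {2}pair_sum_swap -pair_sumD -[RHS](pair_sum0 A B s); apply: eq_pair_sum => // e m uem sem.
have oem : all oprime (e ++ m) by apply/allP => q /sem; apply: (allP os).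
have [oe om] : all oprime e /\ all oprime m by apply/andP; rewrite -all_cat.
rewrite /F jacobi_reciprocity // mulrA -mulrDl.
set w := qr_sign _ _.
have kk : w * w = 1 by rewrite /w /qr_sign; case: ifP.
rewrite (_ : _ * _ + _ = w * (f (lprod e) (lprod m) + w * f (lprod m) (lprod e))).
  by rewrite fE ?odd_lprod // mulr0 mul0r.
by rewrite mulrDr mulrA kk mul1r mulrC.
Qed.

(** For [t = 2] the middle coefficient is arbitrary and [M %/ a] is the absolute value of the
    discriminant at leading coefficient [a] up to sign. For [t = 0] the middle coefficient is even
    and 4 has been divided out of the discriminant. *)
Definition sqrt_sum (t : nat) (b : bool) (M : nat) : int :=
  \sum_(a <- divisors M) nsqrt ((-1) ^+ b * (M %/ a)%N%:Z) (2 ^ t * a).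

(** The prime 2 is split off first; then [sum_divisors_odd] applies for each power [2 ^ j] in the
    discriminant, with [c = (-1) ^+ b * 2 ^+ j]. The symbols of -1 and 2 over [e] become the [chi4]
    and [chi8] factors of [local2]. *)
Lemma sqrt_sumE (t k N : nat) (b : bool) : (0 < N)%N -> odd N ->
  sqrt_sum t b (2 ^ k * N) =
  pair_sum (fun p => weight0 p (logn p N)) (fun p => weight1 p (logn p N)) (primes N)
    (fun e m => local2 t k b (lprod e) (lprod m) * jacobi (lprod m) e).
Proof.
move=> N0 No.
have os : all oprime (primes N).
  apply/allP => p; rewrite mem_primes => /and3P [pp _ pN].
  by rewrite /oprime pp; apply: dvdn_odd pN No.
have us : uniq (primes N) by exact: primes_uniq.
have NE : N = (\prod_(p <- primes N) p ^ logn p N)%N.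
  by rewrite {1}(prod_prime_decomp N0) prime_decompE big_map.
rewrite /sqrt_sum (@sum_divisors_primeX 2 k N
  (fun a d => nsqrt ((-1) ^+ b * d%:Z) (2 ^ t * a))) //; last by lia.
set A := fun p => weight0 p _; set B := fun p => weight1 p _.
pose h j (d : nat) := nsqrt (2 ^+ j * ((-1) ^+ b * d%:Z)) (2 ^ (t + (k - j))).
have sgn_odd (d : nat) : odd d -> ~~ (2 %| (-1) ^+ b * d%:Z)%Z.
  by move=> d1; rewrite dvdzE abszM abszX /= exp1n mul1n dvdn2 d1.
have cE (e : seq nat) j : all oprime e -> all (fun p : nat => ~~ (p%:Z %| (2 ^+ j : int))%Z) e.
  move=> oe; apply/allP => p pe; have /andP [pp po] := allP oe p pe.
  rewrite dvdzE abszX absz_nat -[absz 2]/2%N Euclid_dvdX // dvdn_prime2 // negb_and.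
  by apply/orP; left; apply: contraTneq po => ->.
rewrite (eq_big_nat _ _ (F2 := fun j => pair_sum A B (primes N)
   (fun e m => h j (lprod m) * jacobi ((-1) ^+ b * 2 ^+ j * (lprod m)%:Z) e))); last first.
  move=> j jk; rewrite -(@sum_divisors_odd (primes N) (fun p => logn p N) _ (h j)) //.
  - rewrite -NE big_seq [RHS]big_seq; apply: eq_bigr => a; rewrite -dvdn_divisors // => aN.
    rewrite mulnA -expnD nsqrtM ?expn_gt0 ?(dvdn_gt0 N0 aN) //; last first.
      by rewrite coprimeXl // prime_coprime // dvdn2 negbK (dvdn_odd aN No).
    rewrite /h PoszM -[(2 ^ j)%N%:Z]natz natrX natz.
    by congr (nsqrt _ _ * nsqrt _ _); ring.
  - move=> p ps; have /andP [pp po] := allP os p ps.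
    rewrite dvdz_primeM // negb_or; apply/andP; split.
      by rewrite dvdzE abszX /= exp1n Euclid_dvd1.
    by have /allP := cE _ j os; apply.
  - move=> p d ps; have /andP [pp po] := allP os p ps.
    rewrite /h -mulnn !PoszM -expr2.
    rewrite (_ : 2 ^+ j * _ = p%:Z ^+ 2 * (2 ^+ j * ((-1) ^+ b * d%:Z))); last by ring.
    rewrite nsqrt_sqM ?expn_gt0 // coprimezE !absz_nat coprimeXr // prime_coprime //.
    by rewrite dvdn_prime2 //; apply: contraTneq po => ->.
rewrite pair_sum_big; apply: eq_pair_sum => // e m uem sem.
have oem : all oprime (e ++ m) by apply/allP => q /sem; apply: (allP os).
have [oe om] : all oprime e /\ all oprime m by apply/andP; rewrite -all_cat.
have mo := odd_lprod om.
rewrite /local2 -mulrA mulr_suml mulr_sumr; apply: eq_bigr => j _.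
rewrite /h (@nsqrt_pow2E _ _ ((if b then 7 else 1) * lprod m %% 8)%N) ?sgn_odd //; last first.
  by case: b {h sgn_odd}; rewrite ?expr1 ?expr0; lia.
have e1 : all (fun p : nat => ~~ (p%:Z %| (-1) ^+ b)%Z) e.
  apply/allP => p pe; have /andP [pp po] := allP oe p pe.
  by rewrite dvdzE abszX /= exp1n Euclid_dvd1.
have em : all (fun p : nat => ~~ (p%:Z %| (lprod m)%:Z)%Z) e.
  apply/allP => p pe; have /andP [pp po] := allP oe p pe.
  rewrite dvdzE !absz_nat prime_dvd_lprod //; apply: contraTN uem => pm.
  by rewrite cat_uniq !negb_and negbK; apply/orP; right; apply/orP; left; apply/hasP; exists p.
rewrite jacobiM //; last first.
  apply/allP => p pe; have /andP [pp po] := allP oe p pe.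
  by rewrite dvdz_primeM // negb_or (allP e1) //; have /allP := cE _ j oe; apply.
rewrite jacobiM // ?cE //.
have -> : jacobi (2 ^+ j) e = chi8 (lprod e) ^+ j.
  elim: j => [|j IHj].
    rewrite !expr0 /jacobi big1_seq // => p /andP [_ pe].
    by have /andP [pp po] := allP oe p pe; rewrite legendre1.
  by rewrite !exprS jacobiM ?cE // ?IHj ?jacobi2 //; exact: (cE _ 1%N).
have -> : jacobi ((-1) ^+ b) e = if b then chi4 (lprod e) else 1.
  case: b {h sgn_odd e1} => /=; first by rewrite expr1 jacobiN1.
  rewrite expr0 /jacobi big1_seq // => p /andP [_ pe].
  by have /andP [pp po] := allP oe p pe; rewrite legendre1.
by ring.
Qed.

Lemma sqrt_sum_reflection (M : nat) : (0 < M)%N ->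
  2 * sqrt_sum 0 false M = sqrt_sum 2 false M + sqrt_sum 2 true M /\
  sqrt_sum 0 false M + sqrt_sum 0 true M = sqrt_sum 2 false M.
Proof.
move=> M0; have [N c2 ->] := pfactor_coprime (isT : prime 2) M0.
rewrite mulnC; set k := logn _ _.
have No : odd N by move: c2; rewrite coprime2n.
have N0 : (0 < N)%N by case: N No {c2 k}.
have os : all oprime (primes N).
  apply/allP => p; rewrite mem_primes => /and3P [pp _ pN].
  by rewrite /oprime pp; apply: dvdn_odd pN No.
rewrite !sqrt_sumE //; set A := fun p => weight0 p _; set B := fun p => weight1 p _.
have us := primes_uniq N.
have H1 := @pair_sum_antisym A B _ (defect1 k) os us (fun E M Eo Mo => (defect_antisym k Eo Mo).1).
have H2 := @pair_sum_antisym A B _ (defect2 k) os us (fun E M Eo Mo => (defect_antisym k Eo Mo).2).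
split; apply/eqP; rewrite -subr_eq0; apply/eqP.
  rewrite -[RHS]H1 -!pair_sumZ -!pair_sumD -mulN1r -!pair_sumZ -!pair_sumD.
  by apply: ext_pair_sum => e m; rewrite /defect1; ring.
rewrite -[RHS]H2 -!pair_sumD -mulN1r -!pair_sumZ -!pair_sumD.
by apply: ext_pair_sum => e m; rewrite /defect2; ring.
Qed.

(** * Counting classes *)

Lemma num_classes_seq (I : eqType) (X : seq I) (F : I -> {poly int}) (A : set {poly int}) :
  uniq X -> (forall x, x \in X -> A (F x)) ->
  (forall f, A f -> exists2 x, x \in X & tclass f = tclass (F x)) ->
  {in X &, forall x y, tclass (F x) = tclass (F y) -> x = y} ->
  num_classes A = size X.
Proof.
move=> uX XA AX inj; pose L := map (fun x => tclass (F x)) X.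
have uL : uniq L by rewrite map_inj_in_uniq.
have -> : size X = size (undup L) by rewrite undup_id // size_map.
rewrite -card_fseq /num_classes; congr (#|` _|%fset).
rewrite -[RHS]set_fsetK; congr fset_set; apply/seteqP; split => C /=.
  by move=> [f /AX [x xX ->] <-]; rewrite inE; apply/mapP; exists x.
by rewrite inE => /mapP [x xX ->]; exists (F x) => //; exact: XA.
Qed.

Lemma size_mkquad (a b c : int) : a != 0 -> size (mkquad a b c) = 3%N.
Proof.
move=> a0; apply/eqP; rewrite eqn_leq; apply/andP; split.
  apply/leq_sizeP => -[|[|[|j]]] // _.
  by rewrite !(coefD, coefZ, coefXn, coefX, coefC) /= !mulr0 !addr0.
rewrite ltnNge; apply: contra a0 => /leq_sizeP /(_ 2%N (leqnn _)).
by rewrite mkquad_coef => ->.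
Qed.

Section CountClasses.
Variables (n : int) (P : int -> int -> bool).
Hypotheses (n0 : n != 0) (PD : forall a b t, P a (b + 2 * a * t) = P a b).

Let N := absz n.
Let N0 : (0 < N)%N. Proof. by rewrite absz_gt0. Qed.

(** [s] marks a negative discriminant. As leading coefficient times discriminant is [n], this fixes
    the sign of the leading coefficient. *)
Let sa (s : bool) (a : nat) : int := (-1) ^+ (s (+) (n < 0)%R) * a%:Z.
Let D (s : bool) (a : nat) : int := (-1) ^+ s * (N %/ a)%N%:Z.
Let cond (x : bool * nat * nat) : bool :=
  ((4 * x.1.2)%N%:Z %| x.2%:Z ^+ 2 - D x.1.1 x.1.2)%Z && P (sa x.1.1 x.1.2) x.2%:Z.
Let F (x : bool * nat * nat) : {poly int} :=
  mkquad (sa x.1.1 x.1.2) x.2%:Z ((x.2%:Z ^+ 2 - D x.1.1 x.1.2) %/ (4 * sa x.1.1 x.1.2))%Z.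
Let trip : seq (bool * nat * nat) :=
  [seq (y, b) | y <- [seq (s, a) | s <- [:: false; true], a <- divisors N], b <- iota 0 (2 * y.2)].
Let X := [seq x <- trip | cond x].

Let mem_trip s a b : ((s, a, b) \in trip) = (a %| N)%N && (b < 2 * a)%N.
Proof.
apply/allpairsPdep/andP.
  move=> [y [b' [/allpairsPdep [s' [a' [_ aN ->]]] bl [_ aE bE]]]].
  by move: bl aN; rewrite -aE -bE mem_iota dvdn_divisors.
move=> [aN ba]; exists (s, a), b; split=> //; last by rewrite mem_iota.
apply/allpairsPdep; exists s, a; split => //=; last by rewrite -dvdn_divisors.
by case: s.
Qed.

Let sa_neq0 s a : (a %| N)%N -> sa s a != 0.
Proof.
by move=> aN; rewrite /sa mulf_neq0 ?signr_eq0 // -lt0n; apply: dvdn_gt0 N0 aN.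
Qed.

Let absz_sa s a : absz (sa s a) = a.
Proof. by rewrite /sa abszMsign. Qed.

Let saD s a : (a %| N)%N -> sa s a * D s a = n.
Proof.
move=> aN; rewrite /sa /D mulrACA -PoszM [(a * _)%N]mulnC divnK // -signr_addb addbAC addbb addFb.
by rewrite /N [n in RHS]intEsign.
Qed.

Let dvd4 s a z : ((4 * a)%N%:Z %| z)%Z = (4 * sa s a %| z)%Z.
Proof. by rewrite !dvdzE (abszM 4) absz_sa. Qed.

Let discF x : x \in X -> disc (F x) = D x.1.1 x.1.2.
Proof.
rewrite mem_filter => /andP [/andP [+ _] _]; rewrite (dvd4 x.1.1) => /divzK dE.
rewrite /disc /F !mkquad_coef; set c := (_ %/ _)%Z in dE *.
rewrite (_ : _ - _ = x.2%:Z ^+ 2 - c * (4 * sa x.1.1 x.1.2)); last by ring.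
by rewrite dE; ring.
Qed.

Let uniq_trip : uniq trip.
Proof.
apply: allpairs_uniq_dep => [||].
- by apply: allpairs_uniq => //; [exact: divisors_uniq|move=> [? ?] [? ?]].
- by move=> y _; exact: iota_uniq.
by move=> [y b] [y' b'] _ _ /= [-> ->].
Qed.

(** Translation fixes the leading coefficient and moves the middle one by a multiple of twice it, so
    two reduced middle coefficients in one class coincide. *)
Let F_inj : {in X &, forall x y, tclass (F x) = tclass (F y) -> x = y}.
Proof.
move=> [[s a] b] [[s' a'] b']; rewrite !mem_filter !mem_trip.
move=> /andP [_ /andP [aN ba]] /andP [_ /andP [a'N ba']] e.
have : tclass (F (s, a, b)) (F (s', a', b')).
  by rewrite e; exists 0 => //; rewrite /translate addr0 comp_polyXr.
move=> [t _]; rewrite /F translate_mkquad /= => E.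
have e2 := congr1 (fun f : {poly int} => f`_2) E.
have e1 := congr1 (fun f : {poly int} => f`_1) E.
move: e2 e1; rewrite /= !mkquad_coef => e2 e1.
have aa : a = a' by rewrite -(absz_sa s a) e2 absz_sa.
subst a'; have a0 : (0 < a)%N by exact: dvdn_gt0 N0 aN.
have ss : s = s'.
  move: e2; rewrite /sa => /(mulIf (_ : a%:Z != 0)) H.
  have {}H : (-1) ^+ (s (+) (n < 0)) = (-1) ^+ (s' (+) (n < 0)) :> int by apply: H; lia.
  by move: H; case: (s); case: (s'); case: (n < 0).
subst s'; congr (_, _, _); apply/eqP.
rewrite -(@dvdz_lt_eq (2 * a)) // dvdzE absz_nat -{1}(absz_sa s a) -[2%N]/(absz 2) -abszM -dvdzE.
by apply/dvdzP; exists (- t); rewrite -e1; ring.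
Qed.

(** Each class has one representative with middle coefficient reduced modulo twice the leading one.
    Its constant coefficient is then determined by [n], and is an integer exactly under the
    divisibility condition. *)
Lemma num_classesE :
  (num_classes (quads n `&` [set f | P f`_2 f`_1])%classic)%:Z =
  \sum_(s <- [:: false; true]) \sum_(a <- divisors N) \sum_(0 <= b < 2 * a)
    (((4 * a)%N%:Z %| b%:Z ^+ 2 - (-1) ^+ s * (N %/ a)%N%:Z)%Z
      && P ((-1) ^+ (s (+) (n < 0)%R) * a%:Z) b%:Z)%:R.
Proof.
rewrite (@num_classes_seq _ X F) //.
- rewrite /X size_filter -sum1_count -natz big_mkcond natr_sum /trip big_allpairs_dep big_allpairs_dep.
  apply: eq_bigr => s _; apply: eq_bigr => a _; rewrite /index_iota subn0; apply: eq_bigr => b _.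
  by rewrite -/(sa s a) -/(D s a) -/(cond (s, a, b)); case: (cond _).
- exact: filter_uniq uniq_trip.
- move=> x xX; have := discF xX; move: xX; case: x => [[s a] b].
  rewrite mem_filter mem_trip => /andP [/andP [_ Px] /andP [aN ba]] dF; split=> /=.
    split; first by rewrite size_mkquad // sa_neq0.
    by rewrite dF /F mkquad_coef saD.
  by rewrite /F !mkquad_coef.
- move=> f [[sf fn] /= Pf].
  move: fn Pf; rewrite (@mkquadE f) ?sf //.
  move: (f`_2) (f`_1) (f`_0) => a b c {sf}.
  rewrite /disc !mkquad_coef => fn Pf.
  have a0 : a != 0 by apply: contra_neq n0 => a0; rewrite -fn a0 mul0r.
  have a20 : 2 * a != 0 by rewrite mulf_neq0.
  pose t := - (b %/ (2 * a))%Z.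
  rewrite -(tclass_translate t) translate_mkquad.
  rewrite -(PD a b t) in Pf.
  have fn' : a * ((b + 2 * a * t) ^+ 2 - 4 * a * (a * t ^+ 2 + b * t + c)) = n by rewrite -fn; ring.
  move: Pf fn'; set b' := b + _; set c' := _ + c => Pf fn'.
  have b'E : b' = (b %% (2 * a))%Z by rewrite /b' /t {1}(divz_eq b (2 * a)); ring.
  have b'0 : 0 <= b' by rewrite b'E modz_ge0.
  have b'lt : b' < `|2 * a| by rewrite b'E ltz_mod.
  have b'a : (absz b')%:Z = b' by rewrite gez0_abs.
  pose d := b' ^+ 2 - 4 * a * c'.
  have d0 : d != 0 by apply: contra_neq n0; rewrite -fn' -/d => ->; rewrite mulr0.
  have NE : N = (absz d * absz a)%N by rewrite /N -fn' abszM mulnC.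
  have saE : sa (d < 0) (absz a) = a.
    rewrite /sa -fn' -/d [RHS]intEsign; congr ((-1) ^+ nat_of_bool _ * _).
    by case: (ltgtP a 0) a0 => // ha _; case: (ltgtP d 0) d0 => // hd _;
      rewrite ?(nmulr_llt0 _ hd) ?(pmulr_llt0 _ hd) ?ha //=; lia.
  have DE : D (d < 0) (absz a) = d.
    rewrite /D NE mulnK ?absz_gt0 //; by rewrite [RHS]intEsign.
  exists ((d < 0), absz a, absz b').
    rewrite mem_filter mem_trip /cond /= saE DE b'a Pf andbT; apply/and3P; split.
    + rewrite /d (_ : _ - _ = 4 * a * c'); last by ring.
      by rewrite dvdzE PoszM !abszM absz_nat dvdn_mulr.
    + by rewrite NE dvdn_mull.
    + by move: b'lt; lia.
  rewrite /F /= saE DE b'a; congr (tclass (mkquad _ _ _)).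
  rewrite /d (_ : _ - _ = c' * (4 * a)); last by ring.
  by rewrite mulzK // mulf_neq0.
Qed.

End CountClasses.

(** [b] and [b + 2 * a] have the same square modulo [4 * a], so the reduced range holds half of the
    roots. *)
Lemma sum2_nsqrt (a : nat) (d : int) :
  2 * (\sum_(0 <= b < 2 * a) ((4 * a)%N%:Z %| b%:Z ^+ 2 - d)%Z%:R) = nsqrt d (2 ^ 2 * a).
Proof.
rewrite /nsqrt (_ : index_iota 0 (2 ^ 2 * a) = index_iota 0 (2 * (2 * a))); last by rewrite mulnA.
rewrite (@sum_periodic _ 2 (2 * a)); first by rewrite sumrMnl mulr_natl.
move=> x; congr ((nat_of_bool _)%:R).
by apply: (@dvdz_congr _ _ _ (x%:Z + a%:Z)); rewrite !(PoszM, PoszD); ring.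
Qed.

(** With the middle coefficient [2 * y], a factor 4 cancels when [a] divides [M]. Other divisors
    contribute nothing, since the divisibility forces 4 to divide [4 * M %/ a], hence [a] to divide
    [M]. *)
Lemma sum_even_nsqrt (M : nat) (s : bool) : (0 < M)%N ->
  \sum_(a <- divisors (4 * M)) \sum_(0 <= b < 2 * a)
    (((4 * a)%N%:Z %| b%:Z ^+ 2 - (-1) ^+ s * (4 * M %/ a)%N%:Z)%Z && (2 %| b%:Z)%Z)%:R
  = sqrt_sum 0 s M.
Proof.
move=> M0; have M40 : (0 < 4 * M)%N by rewrite muln_gt0.
rewrite /sqrt_sum.
have pe : perm_eq [seq a <- divisors (4 * M) | (a %| M)%N] (divisors M).
  apply: uniq_perm; rewrite ?filter_uniq ?divisors_uniq // => a.
  rewrite mem_filter -!dvdn_divisors //; case aM : (a %| M)%N => //=.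
  by rewrite dvdn_mull.
rewrite -(perm_big _ pe) big_filter [RHS]big_mkcond [LHS]big_seq [RHS]big_seq.
apply: eq_bigr => a; rewrite -dvdn_divisors // => a4M.
rewrite (@sum_multiples _ 2 a) //; last first.
  by move=> x x2; rewrite (_ : (2 %| x%:Z)%Z = false) ?andbF //; exact: negbTE.
case: ifP => aM; last first.
  apply: big1 => y _; case: (boolP (_ && _)) => // /andP [/dvdzP [m mE] _].
  case/negP: aM; case/dvdnP: a4M => d dE.
  have a0 : (0 < a)%N by case: a {mE} dE => //; lia.
  move: mE; rewrite dE mulnK // => mE.
  have : (4 %| d)%N.
    suff : (4 %| (-1) ^+ s * d%:Z)%Z by rewrite dvdzE abszMsign.
    apply/dvdzP; exists (y%:Z ^+ 2 - m * a%:Z).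
    by rewrite mulrBl -[m * _ * _]mulrA [a%:Z * 4]mulrC -PoszM -mE !PoszM; ring.
  move=> /dvdnP [d' d'E]; apply/dvdnP; exists d'.
  by apply/eqP; rewrite -(eqn_pmul2l (isT : 0 < 4)%N) dE d'E; apply/eqP; ring.
rewrite /nsqrt expn0 mul1n; apply: eq_bigr => y _; congr ((nat_of_bool _)%:R).
rewrite -muln_divA // (_ : (2 %| (2 * y)%N%:Z)%Z) ?andbT; last by rewrite dvdzE absz_nat dvdn_mulr.
rewrite !PoszM (_ : _ - _ = 4 * (y%:Z ^+ 2 - (-1) ^+ s * (M %/ a)%N%:Z)); last by ring.
by rewrite dvdz_mul2l.
Qed.

(** * The four counts as square-root sums *)

Lemma real_sign (n : int) (s : bool) (a : nat) : n != 0 -> (0 < a)%N ->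
  (0 < (-1) ^+ (s (+) (n < 0)%R) * a%:Z * n) = ~~ s.
Proof.
move=> n0 a0; rewrite [X in _ * X](intEsign n) mulrACA -signr_addb addbK -PoszM.
have : (0 < a * absz n)%N by rewrite muln_gt0 a0 absz_gt0.
by case: s; rewrite ?expr1 ?expr0; lia.
Qed.

(** The discriminant is multiplied by the square of the leading coefficient. Having real roots
    becomes a condition on the leading coefficient, the form that [num_classesE] accepts. *)
Lemma quads_real (n : int) f : quads n f -> n != 0 -> (0 < disc f) = (0 < f`_2 * n).
Proof.
move=> [_ fn] n0; rewrite -fn mulrA -expr2; apply/esym/pmulr_rgt0.
rewrite exprn_even_gt0 //=; apply: contra_neq n0 => f0.
by rewrite -fn f0 mul0r.
Qed.

Lemma q_sqrt_sum (n : int) : n != 0 ->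
  2 * (q n)%:Z = sqrt_sum 2 false (absz n) + sqrt_sum 2 true (absz n).
Proof.
move=> n0; rewrite /q.
have -> : quads n = (quads n `&` [set f | (fun _ _ : int => true) f`_2 f`_1])%classic.
  by apply/seteqP; split => f //= [].
rewrite (@num_classesE n (fun _ _ : int => true)) // big_cons big_seq1 mulrDr !mulr_sumr.
by congr (_ + _); apply: eq_bigr => a _; rewrite -sum2_nsqrt; congr (_ * _);
  apply: eq_bigr => b _; rewrite andbT.
Qed.

Lemma qp_sqrt_sum (n : int) : n != 0 ->
  2 * (qp n)%:Z = sqrt_sum 2 false (absz n).
Proof.
move=> n0; rewrite /qp; have N0 : (0 < absz n)%N by rewrite absz_gt0.
have -> : (quads n `&` real_roots = quads n `&`
    [set f | (fun a _ : int => 0 < a * n) f`_2 f`_1])%classic.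
  by apply/seteqP; split => f /= [qf]; rewrite /real_roots /= (quads_real qf).
rewrite (@num_classesE n (fun a _ : int => 0 < a * n)) // big_cons big_seq1 mulrDr !mulr_sumr.
(* Real roots exclude negative discriminants, so the part with [s = true] vanishes. *)
rewrite [X in _ + X](_ : _ = 0) ?addr0.
  rewrite big_seq [RHS]big_seq; apply: eq_bigr => a; rewrite -dvdn_divisors // => aN.
  rewrite -sum2_nsqrt; congr (_ * _); apply: eq_bigr => b _.
  by rewrite real_sign ?(dvdn_gt0 N0 aN) // andbT.
rewrite big_seq; apply: big1 => a; rewrite -dvdn_divisors // => aN.
rewrite big1 ?mulr0 // => b _.
by rewrite real_sign ?(dvdn_gt0 N0 aN) // andbF.
Qed.

Lemma q2_sqrt_sum (n : int) : n != 0 ->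
  (q2 (4 * n))%:Z = sqrt_sum 0 false (absz n) + sqrt_sum 0 true (absz n).
Proof.
move=> n0; have n40 : 4 * n != 0 by rewrite mulf_neq0.
have N0 : (0 < absz n)%N by rewrite absz_gt0.
have -> : q2 (4 * n) = num_classes (quads (4 * n) `&`
    [set f | (fun _ b : int => (2 %| b)%Z) f`_2 f`_1])%classic by [].
rewrite (@num_classesE (4 * n) (fun _ b : int => (2 %| b)%Z)) //; last first.
  by move=> a b t; rewrite rpredDr // -mulrA dvdz_mulr.
by rewrite big_cons big_seq1 abszM -!sum_even_nsqrt.
Qed.

Lemma q2p_sqrt_sum (n : int) : n != 0 ->
  (q2p (4 * n))%:Z = sqrt_sum 0 false (absz n).
Proof.
move=> n0; have n40 : 4 * n != 0 by rewrite mulf_neq0.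
have N0 : (0 < absz n)%N by rewrite absz_gt0.
have N40 : (0 < absz (4 * n)%R)%N by rewrite absz_gt0.
rewrite /q2p.
have -> : (quads (4 * n) `&` (even_mid `&` real_roots) = quads (4 * n) `&`
    [set f | (fun a b : int => (2 %| b)%Z && (0 < a * (4 * n))) f`_2 f`_1])%classic.
  apply/seteqP; split => f /= [qf]; rewrite /real_roots /even_mid /= (quads_real qf) //.
    by move=> [-> ->].
  by move/andP.
rewrite (@num_classesE (4 * n) (fun a b : int => (2 %| b)%Z && (0 < a * (4 * n)))) //; last first.
  by move=> a b t; rewrite rpredDr // -mulrA dvdz_mulr.
rewrite big_cons big_seq1 [X in _ + X](_ : _ = 0) ?addr0.
  rewrite -sum_even_nsqrt // -[(4 * absz n)%N](abszM 4) big_seq [RHS]big_seq.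
  apply: eq_bigr => a; rewrite -dvdn_divisors // => aN.
  by apply: eq_bigr => b _; rewrite real_sign ?(dvdn_gt0 N40 aN) // andbT.
rewrite big_seq; apply: big1 => a; rewrite -dvdn_divisors // => aN.
by apply: big1 => b _; rewrite real_sign ?(dvdn_gt0 N40 aN) // !andbF.
Qed.

Theorem theorem1p4 (n : int) (hn : n <> 0) :
  q2p (4 * n) = q n /\ q2 (4 * n) = (2 * qp n)%N.
Proof.
move/eqP: hn => n0.
have := q_sqrt_sum n0; have := qp_sqrt_sum n0; have := q2_sqrt_sum n0; have := q2p_sqrt_sum n0.
have [|h1 h2] := @sqrt_sum_reflection (absz n); first by rewrite absz_gt0.
(* Twice [q n] is twice [sqrt_sum 0 false], which is [q2p (4 * n)]; and [q2 (4 * n)] is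
   [sqrt_sum 2 false], which is twice [qp n]. *)
by lia.
Qed.
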